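(* Let $(\Omega,d)$ be a separable metric space, $\Theta\subset\mathbb R^p$ open, $\{\mu_\theta:\theta\in\Theta\}$ a family of Borel probability measures on $\Omega$, $\mu$ a Borel probability measure on $\Omega$, and $X_1,X_2,\ldots$ iid with law $\mu$. Consider a measurable $\Theta$-valued estimator $\hat\theta=\hat\theta_n$ based on $X_1,\ldots,X_n$, and assume that there exists $\theta_1\in\Theta$ such that $\hat\theta\to\theta_1$ in probability. Assume also that $\theta\mapsto F^{\mu_\theta}$ is continuous at $\theta_1$ as a map from $\Theta$ into $\ell^\infty(\Omega\times\mathbb R_{\ge0})$, that is, $$\sup_{\omega\in\Omega,t\ge0}\big|F_\omega^{\mu_\theta}(t)-F_\omega^{\mu_{\theta_1}}(t)\big|\to0\quad\text{as }\theta\to\theta_1.$$ Let $\tilde T_n^{\mathrm{KS}},\tilde T_n^{\mathrm{CM}},\hat T_n^{\mathrm{KS}},\hat T_n^{\mathrm{CM}}$ be as defined in the context. Suppose the fixed alternative $H_1:\mu\notin\{\mu_\theta:\theta\in\Theta\}$ holds. Then: (KS) $\tilde T_n^{\mathrm{KS}}$ diverges to infinity in outer probability. If, in addition, $\sup_{\omega\in\Omega,t\ge0}\|\dot F_\omega^{\hat\theta}(t)\|\,\|\hat V^{-1}\|=O_{\mathsf P}(1)$ and $\frac1n\sum_{i=1}^n\psi_{\hat\theta}(X_i)=o_{\mathsf P}(1)$, then $\hat T_n^{\mathrm{KS}}$ diverges to infinity in outer probability. (CM) If the measures $\mu$ and $\mu_\theta$ satisfy the doubling condition (condition (a2) in the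 context), or if there is $\alpha>0$ such that $(\Omega,d^\alpha)$ is of strong negative type (condition (a1) in the context) and $\mathrm{supp}(\mu_{\theta_1})\subset\mathrm{supp}(\mu)$, then $\tilde T_n^{\mathrm{CM}}$ also diverges to infinity in outer probability. If, in addition, $\sup_{\omega\in\Omega,t\ge0}\|\dot F_\omega^{\hat\theta}(t)\|\,\|\hat V^{-1}\|=O_{\mathsf P}(1)$ and $\frac1n\sum_{i=1}^n\psi_{\hat\theta}(X_i)=o_{\mathsf P}(1)$, then $\hat T_n^{\mathrm{CM}}$ diverges to infinity in outer probability.
   Context: For a Borel probability measure $\nu$ on $\Omega$, the distance profile of $\nu$ at $\omega$ is $F_\omega^\nu(t)=\nu(\{x:d(\omega,x)\le t\})$, $t\ge0$. The empirical profile is $F_{n,\omega}(t)=\frac1n\sum_{i=1}^n1_{\{d(\omega,X_i)\le t\}}$, $P_n=\frac1n\sum_{i=1}^n\delta_{X_i}$, and $\dot F_\omega^{\theta}(t)=\partial F_\omega^{\mu_\theta}(t)/\partial\theta\in\mathbb R^p$ (gradient, whenever it exists). $\psi_\theta:\Omega\to\mathbb R^p$ are measurable estimating functions and $\hat V$ is a random (measurable) $p\times p$ matrix, invertible with probability tending to one. Processes: $\mathbb G_n^{\hat\theta}(\omega,t)=\sqrt n\,(F_{n,\omega}(t)-F_\omega^{\mu_{\hat\theta}}(t))$ and $\hat{\mathbb G}_n(\omega,t)=\sqrt n\,P_n\hat f_{\omega,t}$, where $\hat f_{\omega,t}(x)=1_{\{d(\omega,x)\le t\}}-F_\omega^{\mu_{\hat\theta}}(t)+\dot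 F_\omega^{\hat\theta}(t)^\top\hat V^{-1}\psi_{\hat\theta}(x)$. Statistics: $\tilde T_n^{\mathrm{KS}}=\sup_{\omega,t}|\mathbb G_n^{\hat\theta}(\omega,t)|$, $\tilde T_n^{\mathrm{CM}}=\int_{\Omega\times\mathbb R_{\ge0}}\mathbb G_n^{\hat\theta}(\omega,t)^2\,\mathrm dF_{n,\omega}(t)\,\mathrm dP_n(\omega)=n^{-2}\sum_{i,j}\mathbb G_n^{\hat\theta}(X_i,d(X_i,X_j))^2$; $\hat T_n^{\mathrm{KS}},\hat T_n^{\mathrm{CM}}$ are defined in the same way with $\hat{\mathbb G}_n$ in place of $\mathbb G_n^{\hat\theta}$. $\mathrm{supp}(\nu)$ is the closure of the set of points all of whose open neighborhoods have positive $\nu$-mass. $T_n$ diverges to infinity in outer probability if $\mathsf P^*(T_n\le K)\to0$ for every $K<\infty$, with $\mathsf P^*$ the outer probability. Standing assumptions: (b1) $\varepsilon\log N(\varepsilon,\Omega,d)\to0$ as $\varepsilon\to0^+$, with $N(\varepsilon,\Omega,d)$ the covering number. (b2') for $\nu\in\{\mu,\mu_{\theta_1}\}$ there is $K_\nu>0$ with $\sup_{\omega\in\Omega}|F_\omega^\nu(r)-F_\omega^\nu(s)|\le K_\nu|r-s|$ for all $r,s\ge0$. At least one of: (a1) there is $\alpha>0$ such that $(\Omega,d^\alpha)$ is of strong negative type (negative type, and $\iint d^\alpha(x,y)\,\mathrm d(\nu_1-\nu_2)(x)\,\mathrm d(\nu_1-\nu_2)(y)=0$ only if $\nu_1=\nu_2$,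 for Borel probability measures with finite first moment with respect to $d^\alpha$); (a2) the probability measures under consideration ($\nu=\mu$ and $\nu=\mu_\theta$) satisfy the doubling condition: there is $L_\nu<\infty$ with $\limsup_{r\to0^+}\nu(B(\omega,2r))/\nu(B(\omega,r))\le L_\nu$ for every $\omega\in\mathrm{supp}(\nu)$. *)

(* Defs.v *)
From HB Require Import structures.
From mathcomp Require Import all_boot all_order all_algebra finmap.
From mathcomp Require Import all_classical all_reals all_analysis.

Set Implicit Arguments.
Unset Strict Implicit.
Unset Printing Implicit Defensive.

Import Order.TTheory GRing.Theory Num.Theory.
Import numFieldTopology.Exports numFieldNormedType.Exports.

Local Open Scope classical_set_scope.
Local Open Scope ring_scope.

(* Measurable types are pointed in the library, so the metric space has to be
   pointed too. This loses nothing: a space carrying a probability measure is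
   nonempty. *)
#[short(type="pmetricType")]
HB.structure Definition PMetric (R : numDomainType) :=
  {M of Pointed M & Metric R M}.

Definition borel (R : realType) (Omega : pmetricType R) :=
  g_sigma_algebraType (@open Omega).

HB.instance Definition _ (R : realType) (Omega : pmetricType R) :=
  Measurable.on (borel Omega).

Definition separable (U : topologicalType) :=
  exists S : set U, countable S /\ dense S.

Definition same_law d (U : measurableType d) (R : realType)
    (nu1 nu2 : probability U R) :=
  forall A : set U, measurable A -> nu1 A = nu2 A.

Section metric_conditions.
Context {R : realType} (Omega : pmetricType R).
Implicit Types (nu : probability (borel Omega) R) (w x y : Omega) (t e r : R).

Definition profile nu w t : R := fine (nu [set x : Omega | mdist w x <= t]).

(* The norm of l^oo(Omega x R_{>=0}), with value +oo on unbounded functions;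
   also the Kolmogorov-Smirnov functional. *)
Definition sup_norm (g : Omega -> R -> R) : \bar R :=
  ereal_sup [set `|g z.1 z.2|%:E | z in [set z : Omega * R | 0 <= z.2]].

(* Open balls with centers in Omega; +oo if no finite cover exists. *)
Definition covering_number e : \bar R :=
  ereal_inf [set (size s)%:R%:E | s in
    [set s : seq Omega | [set: Omega] `<=` \bigcup_(x in [set` s]) ball x e]].

Definition entropy_condition :=
  (fun e => (e%:E * lne (covering_number e))%E) @ 0^'+ --> (0 : \bar R)%E.

Definition lipschitz_profiles nu :=
  exists2 K : R, 0 < K & forall w (r s : R), 0 <= r -> 0 <= s ->
    `|profile nu w r - profile nu w s| <= K * `|r - s|.

Definition negative_type (rho : Omega -> Omega -> R) :=
  forall (n : nat) (x : 'I_n -> Omega) (c : 'I_n -> R), \sum_i c i = 0 ->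
    \sum_i \sum_j c i * c j * rho (x i) (x j) <= 0.

Definition finite_first_moment (rho : Omega -> Omega -> R) nu :=
  exists w, (\int[nu]_x (rho w x)%:E < +oo)%E.

Definition mutual_energy (rho : Omega -> Omega -> R) nu1 nu2 : \bar R :=
  (\int[nu1]_x \int[nu2]_y (rho x y)%:E)%E.

(* The double integral against nu1 - nu2 is expanded bilinearly; under the
   moment condition all four terms are finite for rho = d^alpha. *)
Definition strong_negative_type (rho : Omega -> Omega -> R) :=
  negative_type rho /\
  forall nu1 nu2, finite_first_moment rho nu1 -> finite_first_moment rho nu2 ->
    (mutual_energy rho nu1 nu1 - mutual_energy rho nu1 nu2
       - mutual_energy rho nu2 nu1 + mutual_energy rho nu2 nu2 = 0)%E ->
    same_law nu1 nu2.

Definition power_strong_negative_type :=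
  exists2 alpha : R, 0 < alpha &
    strong_negative_type (fun x y : Omega => mdist x y `^ alpha).

Definition msupport nu : set Omega :=
  closure [set x : Omega | forall U : set Omega, open U -> U x -> (0 < nu U)%E].

Definition doubling nu :=
  exists L : R, forall w, msupport nu w ->
    (limf_esup (fun r : R =>
       (fine (nu (ball w (2 * r)%R)) / fine (nu (ball w r)))%:E) (0^'+)%R
     <= L%:E)%E.

End metric_conditions.

Section stochastic_notions.
Context d {T : measurableType d} {R : realType} (P : probability T R).

Definition mutually_independent d' (U : measurableType d')
    (X : nat -> {RV P >-> U}) :=
  forall (J : {fset nat}) (A : nat -> set U), (forall i, measurable (A i)) ->
    P (\bigcap_(i in [set` J]) (X i @^-1` A i)) =
    (\prod_(i <- J) P (X i @^-1` A i))%E.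

Definition iid d' (U : measurableType d') (mu : probability U R)
    (X : nat -> {RV P >-> U}) :=
  mutually_independent X /\ forall i, same_law (distribution P (X i)) mu.

(* The next three notions use the outer probability (P^* )%mu, which is P on
   measurable sets, because the sequences need not be measurable. *)
Definition cvg_in_probability (V : normedModType R) (Z : nat -> T -> V)
    (l : V) :=
  forall e : R, 0 < e ->
    (P^*)%mu [set w | e < `|Z n w - l|] @[n --> \oo] --> (0 : \bar R)%E.

Definition bounded_in_probability (Z : nat -> T -> \bar R) :=
  forall e : R, 0 < e -> exists M : R, \forall n \near \oo,
    ((P^*)%mu [set w | (M%:E < `|Z n w|)%E] <= e%:E)%E.

Definition diverges_in_outer_probability (Z : nat -> T -> \bar R) :=
  forall K : R,
    (P^*)%mu [set w | (Z n w <= K%:E)%E] @[n --> \oo] --> (0 : \bar R)%E.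

Definition measurable_mx m n (M : T -> 'M[R]_(m, n)) :=
  forall i j, measurable_fun [set: T] (fun w => M w i j).

End stochastic_notions.

(* A sample is a sequence x = (x 0, x 1, ...), of which the first n terms are
   used. The family mu_ is total; only its values on the parameter set matter. *)
Section processes.
Context {R : realType} (Omega : pmetricType R) (p : nat).
Variable mu_ : 'rV[R]_p -> probability (borel Omega) R.
Variable psi : 'rV[R]_p -> Omega -> 'cV[R]_p.
Implicit Types (n : nat) (x : nat -> Omega) (th : 'rV[R]_p) (V : 'M[R]_p)
  (w : Omega) (t : R).

(* The gradient as a row vector, i.e. the transpose of the column gradient. A
   nonexistent partial derivative has the default value of 'D_. *)
Definition grad_profile th w t : 'rV[R]_p :=
  \row_j 'D_(delta_mx 0 j) (fun th' => profile (mu_ th') w t) th.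

Definition emp_mean (E : lmodType R) n x (f : Omega -> E) : E :=
  n%:R^-1 *: \sum_(i < n) f (x i).

Definition emp_profile n x w t : R :=
  emp_mean n x (fun y => (mdist w y <= t)%R%:R : R^o).

Definition Gproc n x th w t : R :=
  Num.sqrt n%:R * (emp_profile n x w t - profile (mu_ th) w t).

Definition fhat th V w t (y : Omega) : R :=
  (mdist w y <= t)%R%:R - profile (mu_ th) w t
  + (grad_profile th w t *m invmx V *m psi th y) 0 0.

Definition Ghatproc n x th V w t : R :=
  Num.sqrt n%:R * emp_mean n x (fhat th V w t : Omega -> R^o).

Definition KSstat (g : Omega -> R -> R) : \bar R := sup_norm g.

(* The integral of g^2 against dF_{n,w}(t) dP_n(w). *)
Definition CMstat n x (g : Omega -> R -> R) : \bar R :=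
  (n%:R ^- 2 * \sum_(i < n) \sum_(j < n) g (x i) (mdist (x i) (x j)) ^+ 2)%:E.

(* The matrix norms are the library's maximum norms; the choice is immaterial
   for boundedness and convergence in probability. *)
Definition score_bound th V : \bar R :=
  ereal_sup [set (`|grad_profile th z.1 z.2| * `|invmx V|)%:E
             | z in [set z : Omega * R | 0 <= z.2]].

End processes.

(* Main.v *)
Require Import Defs.
From HB Require Import structures.
From mathcomp Require Import all_boot all_order all_algebra finmap.
From mathcomp Require Import all_classical all_reals all_analysis.
From mathcomp Require Import measurable_realfun ring lra.
Set Implicit Arguments.
Unset Strict Implicit.
Unset Printing Implicit Defensive.
Import Order.TTheory GRing.Theory Num.Theory.
Import numFieldTopology.Exports numFieldNormedType.Exports.
Local Open Scope classical_set_scope.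
Local Open Scope ring_scope.

(** Under the alternative the model is identified by distance profiles: there
    are a center and a radius at which the profiles of [mu] and [mu_ theta1]
    differ. The plug-in profile converges uniformly to that of [mu_ theta1], so
    both processes are [sqrt n] times the deviation of the empirical profile
    from the profile of [mu_ theta1], up to a uniform error [o_P (sqrt n)]
    ([Gproc_tracks_deviation], [Ghatproc_tracks_deviation]); the correction in
    the second process is a product of an [O_P(1)] and an [o_P(1)] term.

    Divergence then needs only a law of large numbers for finitely many events
    ([indicator_lln]). For the Kolmogorov-Smirnov functional one center and one
    radius are enough ([KSstat_diverges]). For the Cramer-von Mises functional
    the two profiles must differ at a center [x] and a radius [mdist x y] with
    [x] and [y] in the support of [mu]. Profiles are monotone in the radius, and
    those of the two measures are Lipschitz; hence the discrepancy persists for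
    all pairs of observations near [x] and [y], and these are a positive
    fraction of all pairs ([CMstat_diverges]).

    It remains to identify the measures. If the profiles agree at all radii
    [mdist x y] between support points of [mu], then they agree at all radii for
    every center in the support: between consecutive such distances the profile
    of [mu] is constant, and by monotonicity so is the other one
    ([profile_eq_extend]). Under strong negative type, the profile at [x] is the
    law of the distance to [x], so that all energies coincide and the measures
    are equal, provided that the profiles agree at centers that carry both
    measures ([strong_negative_type_same_law]). Under doubling, a packing by
    balls of one small radius, centered at support points of [mu], captures a
    fixed fraction of the mass of an open set; on these balls the measures
    agree, and iteration gives [mu U <= mu_ theta1 U] for every open [U], hence
    equality ([doubling_same_law]). The entropy condition enters through total
    boundedness of the space. *)

(** * Events of asymptotically vanishing outer probability *)

Section vanishing_events.
Context d {T : measurableType d} {R : realType} (P : probability T R).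
Implicit Types E F : nat -> set T.

Definition vanishing E :=
  (P^*)%mu (E n) @[n --> \oo] --> (0 : \bar R)%E.

Lemma outer_ge0 (A : set T) : (0 <= (P^*)%mu A)%E.
Proof. exact: mu_ext_ge0. Qed.

Lemma outer_subset (A B : set T) : A `<=` B -> ((P^*)%mu A <= (P^*)%mu B)%E.
Proof. exact: le_mu_ext. Qed.

Lemma outer_setU (A B : set T) :
  ((P^*)%mu (A `|` B) <= (P^*)%mu A + (P^*)%mu B)%E.
Proof. exact: outer_measureU2. Qed.

(** Working with eventual bounds rather than with limits in the extended reals
    reduces everything below to monotonicity and finite subadditivity. *)
Lemma vanishingP E : vanishing E <->
  forall e : R, 0 < e -> \forall n \near \oo, ((P^*)%mu (E n) <= e%:E)%E.
Proof.
split=> [/fine_cvgP[fE cE] e e0|H].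
- move/cvgrPdist_le : cE => /(_ e e0); apply: filterS2 fE => n fn /=.
  rewrite sub0r normrN ger0_norm ?fine_ge0 ?outer_ge0// => h.
  by rewrite -(fineK fn) lee_fin.
- have fE : \forall n \near \oo, (P^*)%mu (E n) \is a fin_num.
    have := H 1 ltr01; apply: filterS => n h.
    by rewrite ge0_fin_numE ?outer_ge0// (le_lt_trans h)// ltry.
  apply/fine_cvgP; split => //; apply/cvgrPdist_le => e e0.
  have := H e e0; apply: filterS2 fE => n fn h /=.
  by rewrite sub0r normrN ger0_norm ?fine_ge0 ?outer_ge0// -lee_fin fineK.
Qed.

Lemma sub_vanishing E F : (\forall n \near \oo, E n `<=` F n) ->
  vanishing F -> vanishing E.
Proof.
move=> EF /vanishingP vF; apply/vanishingP => e /vF; apply: filterS2 EF => n.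
by move=> /outer_subset; exact: le_trans.
Qed.

Lemma vanishingU E F : vanishing E -> vanishing F ->
  vanishing (fun n => E n `|` F n).
Proof.
move=> /vanishingP vE /vanishingP vF; apply/vanishingP => e e0.
have e2 : 0 < e / 2 by rewrite divr_gt0.
apply: filterS2 (vE _ e2) (vF _ e2) => n En Fn.
by rewrite (le_trans (outer_setU _ _))// (splitr e) EFinD leeD.
Qed.

End vanishing_events.

(** * A weak law of large numbers for relative frequencies *)

Section indicator_lln.
Context d {T : measurableType d} {R : realType} (P : probability T R).
Context d' {U : measurableType d'} (mu : probability U R).
Variable X : nat -> {RV P >-> U}.
Hypothesis iidX : iid mu X.
Variable A : set U.
Hypothesis mA : measurable A.

Let q : R := fine (mu A).
Let Y (i : nat) : set T := X i @^-1` A.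
Let S (n : nat) (w : T) : R := \sum_(i < n) \1_(Y i) w.

Let mY i : measurable (Y i).
Proof. by rewrite /Y -[X in measurable X]setTI; exact: measurable_funPT. Qed.

Let PY i : P (Y i) = q%:E.
Proof. by rewrite /q fineK ?fin_num_measure// -(iidX.2 i A mA). Qed.

Let PYI i j : i != j -> P (Y i `&` Y j) = (q * q)%:E.
Proof.
move=> ij; have := iidX.1 [fset i; j]%fset (fun=> A) (fun=> mA).
rewrite big_fsetU1 ?big_seq_fset1 ?inE//= !PY EFinM => <-.
congr (P _); apply/seteqP; split=> w /=.
  by move=> [Yi Yj] k /=; rewrite !inE => /orP[] /eqP ->.
by move=> h; split; [apply: (h i)|apply: (h j)]; rewrite /= !inE eqxx ?orbT.
Qed.

Let mS n : measurable_fun setT (S n).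
Proof. by apply: measurable_sum => i; exact: measurable_indic. Qed.

Let S0 n w : 0 <= S n w.
Proof. by apply: sumr_ge0 => i _; rewrite indicE. Qed.

Let intS n : (\int[P]_w (S n w)%:E = (n%:R * q)%:E)%E.
Proof.
under eq_integral do rewrite /S -sumEFin.
rewrite ge0_integral_sum//; last first.
  by move=> i; apply/measurable_EFinP; exact: measurable_indic.
transitivity (\sum_(i < n) q%:E)%E.
  by apply: eq_bigr => i _; rewrite integral_indic// setIT; exact: PY.
by rewrite sumEFin sumr_const card_ord mulr_natl.
Qed.

Let intS2 n :
  (\int[P]_w (S n w ^+ 2)%:E = (n%:R * q + (n%:R ^+ 2 - n%:R) * q ^+ 2)%:E)%E.
Proof.
have -> : (fun w => (S n w ^+ 2)%:E) =
    (fun w => \sum_(i < n) \sum_(j < n) (\1_(Y i `&` Y j) w)%:E)%E.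
  apply/funext => w; rewrite expr2 {1}/S mulr_suml -sumEFin.
  apply: eq_bigr => i _; rewrite mulr_sumr -sumEFin; apply: eq_bigr => j _.
  by rewrite indicI.
have mi (i j : 'I_n) :
    measurable_fun setT (fun w => (\1_(Y i `&` Y j) w : R)%:E).
  by apply/measurable_EFinP; apply: measurable_indic; exact: measurableI.
have i0 (i j : 'I_n) w : (0 <= (\1_(Y i `&` Y j) w : R)%:E)%E.
  by rewrite lee_fin indicE.
rewrite ge0_integral_sum//.
- transitivity (\sum_(i < n) (q + (n%:R - 1) * q ^+ 2)%:E)%E; last first.
    rewrite sumEFin sumr_const card_ord -mulr_natl; congr EFin; ring.
  apply: eq_bigr => i _; rewrite ge0_integral_sum//.
  transitivity (\sum_(j < n) (if j == i then q else q ^+ 2)%:E)%E.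
    apply: eq_bigr => j _; rewrite integral_indic ?setIT//; last first.
      exact: measurableI.
    have [->|ji] := eqVneq j i; first by rewrite setIid; exact: PY.
    rewrite expr2; apply: PYI; apply: contra ji => /eqP ij.
    exact/eqP/val_inj/esym.
  rewrite sumEFin (bigD1 i)//= eqxx; congr (_ + _)%:E.
  rewrite (eq_bigr (fun=> q ^+ 2)) => [|j /negbTE -> //].
  have n0 : (0 < n)%N by exact: leq_ltn_trans (ltn_ord i).
  rewrite sumr_const cardC1 card_ord mulrBl mul1r mulr_natl.
  by rewrite -{2}(prednK n0) [in RHS]mulrSr addrK.
- by move=> i; exact: emeasurable_sum.
- by move=> i x _; exact: sume_ge0.
Qed.

Let mV n : measurable_fun setT (fun w => (S n w - n%:R * q) ^+ 2).
Proof. by apply: measurable_funX; apply: measurable_funB. Qed.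

(* The expansion of the square is rearranged into an identity between sums of
   nonnegative functions. *)
Let intV n :
  (\int[P]_w ((S n w - n%:R * q) ^+ 2)%:E = (n%:R * (q - q ^+ 2))%:E)%E.
Proof.
have q0 : 0 <= q by rewrite fine_ge0.
have c0 : 0 <= 2 * n%:R * q :> R by rewrite !mulr_ge0.
have eqf : (\int[P]_w (((S n w - n%:R * q) ^+ 2)%:E
              + ((2 * n%:R * q)%:E * (S n w)%:E))
          = \int[P]_w ((S n w ^+ 2)%:E + ((n%:R * q) ^+ 2)%:E))%E.
  apply: eq_integral => w _; rewrite -EFinM -!EFinD; congr EFin; ring.
have mS' : measurable_fun setT (fun w => (S n w)%:E) by exact/measurable_EFinP.
have mS2 : measurable_fun setT (fun w => (S n w ^+ 2)%:E).
  by apply/measurable_EFinP; exact: measurable_funX.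
have mcS : measurable_fun setT (fun w => (2 * n%:R * q)%:E * (S n w)%:E)%E.
  by apply/measurable_EFinP; exact: measurable_funM.
have mV' : measurable_fun setT (fun w => ((S n w - n%:R * q) ^+ 2)%:E).
  exact/measurable_EFinP.
have V0 w : (0 <= ((S n w - n%:R * q) ^+ 2)%:E)%E by rewrite lee_fin sqr_ge0.
have S20 w : (0 <= (S n w ^+ 2)%:E)%E by rewrite lee_fin sqr_ge0.
have q20 (w : T) : (0 <= ((n%:R * q) ^+ 2)%:E)%E by rewrite lee_fin sqr_ge0.
have cS0 w : (0 <= (2 * n%:R * q)%:E * (S n w)%:E)%E.
  by rewrite -EFinM lee_fin mulr_ge0.
move: eqf; rewrite !ge0_integralD//; last by move=> w _; exact: q20.
rewrite ge0_integralZl_EFin//; last by move=> w _; rewrite lee_fin.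
rewrite intS intS2 integral_cst//.
rewrite [X in (_ = _ + _ * X)%E -> _](probability_setT P).
rewrite mule1 -EFinM -EFinD.
case: (\int[P]_x ((S n x - n%:R * q) ^+ 2)%:E)%E => [r| |]//= -[rE].
by congr EFin; apply: (addIr (2 * n%:R * q * (n%:R * q))); rewrite rE; ring.
Qed.

(** Chebyshev's inequality: by pairwise independence the variance of a relative
    frequency is at most the inverse of the sample size. *)
Lemma indicator_lln (e : R) : 0 < e ->
  vanishing P (fun n =>
    [set w | e < `|n%:R^-1 * \sum_(i < n) \1_A (X i w) - fine (mu A)|]).
Proof.
move=> e0; apply/vanishingP => h h0.
have c0 : 0 < e ^+ 2 * h by rewrite mulr_gt0// exprn_gt0.
near=> n.
have n0 : (0 < n)%N by near: n; exists 1%N.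
have nR : 0 < n%:R :> R by rewrite ltr0n.
pose B := [set w | (n%:R * e) ^+ 2 <= (S n w - n%:R * q) ^+ 2].
have mB : measurable B.
  by rewrite -[B]setTI; apply: measurable_fun_le.
have sub : [set w | e < `|n%:R^-1 * \sum_(i < n) \1_A (X i w) - q|] `<=` B.
  move=> w /= /ltW ew; rewrite /B/= -[leRHS]real_normK ?num_real//.
  rewrite ler_sqr ?nnegrE ?mulr_ge0 ?(ltW e0)//.
  have -> : S n w - n%:R * q = n%:R * (n%:R^-1 * S n w - q).
    by field; rewrite gt_eqF.
  by rewrite normrM (ger0_norm (ltW nR)) ler_pM2l.
apply: (le_trans (outer_subset P sub)); rewrite measurable_mu_extE//.
have le1 : (((n%:R * e) ^+ 2)%:E * P B <= (n%:R * (q - q ^+ 2))%:E)%E.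
  have -> : P B = (\int[P]_w (\1_B w : R)%:E)%E.
    by rewrite integral_indic// setIT.
  have m1 : measurable_fun setT (fun w => (\1_B w : R)%:E).
    by apply/measurable_EFinP; exact: measurable_indic.
  rewrite -intV -ge0_integralZl_EFin ?sqr_ge0//.
  apply: ge0_le_integral => //.
  - by move=> w _; rewrite -EFinM lee_fin mulr_ge0 ?sqr_ge0// indicE.
  - apply/measurable_EFinP; apply: measurable_funM => //.
  - exact/measurable_EFinP.
  - move=> w _; rewrite -EFinM lee_fin indicE.
    case: (boolP (w \in B)) => [|_]; first by rewrite inE mulr1.
    by rewrite mulr0 sqr_ge0.
have q1 : q - q ^+ 2 <= 1.
  have q1 : q <= 1.
    by rewrite -lee_fin fineK ?fin_num_measure//; exact: probability_le1.
  by apply: le_trans q1; rewrite gerBl sqr_ge0.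
have ne0 : 0 < (n%:R * e) ^+ 2 by rewrite exprn_gt0// mulr_gt0.
rewrite -(lee_pmul2l _ (ne0 : (0 < ((n%:R * e) ^+ 2)%:E)%E))//.
apply: (le_trans le1); rewrite -EFinM lee_fin.
have -> : (n%:R * e) ^+ 2 * h = n%:R * (n%:R * (e ^+ 2 * h)) by ring.
rewrite ler_pM2l// (le_trans q1)// -ler_pdivrMr// mul1r.
by near: n; exact: nbhs_infty_ger.
Unshelve. all: by end_near. Qed.

End indicator_lln.

(** * Profiles, supports and total boundedness *)

Section geometry.
Context {R : realType} (Omega : pmetricType R).
Implicit Types (nu : probability (borel Omega) R) (x y w : Omega) (r s t : R).

Definition cball x t : set Omega := [set y | mdist x y <= t].

Lemma open_borel (A : set Omega) : open A -> measurable (A : set (borel Omega)).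
Proof. exact: sub_sigma_algebra. Qed.

Lemma closed_borel (A : set Omega) :
  closed A -> measurable (A : set (borel Omega)).
Proof.
move=> cA; rewrite -[A]setCK; apply: measurableC; apply: open_borel.
exact: closed_openC.
Qed.

Lemma closed_cball x t : closed (cball x t).
Proof.
rewrite -[cball x t]setCK; apply: open_closedC; rewrite openE => y /= /negP.
rewrite -ltNge => ty; apply/nbhs_ballP; exists (mdist x y - t) => /=.
  by rewrite subr_gt0.
move=> z; rewrite ballEmdist/= => yz; apply/negP; rewrite -ltNge.
have := metric_triangle x z y; rewrite (metric_sym z y); lra.
Qed.

Lemma open_mball x t : open (ball x t).
Proof.
rewrite openE => y; rewrite ballEmdist/= => yt.
apply/nbhs_ballP; exists (t - mdist x y) => /=; first by rewrite subr_gt0.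
move=> z; rewrite ballEmdist/= => yz.
have := metric_triangle x y z; rewrite [in X in X -> _]/=; lra.
Qed.

Lemma measurable_cball x t : measurable (cball x t : set (borel Omega)).
Proof. by apply: closed_borel; exact: closed_cball. Qed.

Lemma profileE nu x t : nu (cball x t) = (profile nu x t)%:E.
Proof. by rewrite fineK// fin_num_measure//; exact: measurable_cball. Qed.

Lemma profile_subset nu x s y t :
  cball x s `<=` cball y t -> profile nu x s <= profile nu y t.
Proof.
move=> st; rewrite -lee_fin -!profileE.
by apply: le_measure; rewrite ?inE; [exact: measurable_cball..|].
Qed.

Lemma profile_homo nu x : {homo profile nu x : s t / s <= t}.
Proof.
move=> s t st; apply: profile_subset => y; rewrite /cball/= => /le_trans; exact.
Qed.

Lemma profile_le1 nu x t : profile nu x t <= 1.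
Proof.
by rewrite -lee_fin -profileE; apply: probability_le1; exact: measurable_cball.
Qed.

Lemma profile_shift nu x y r t : mdist x y <= r ->
  profile nu x t <= profile nu y (t + r).
Proof.
move=> xy; apply: profile_subset => z; rewrite /cball/= => xz.
have := metric_triangle y x z; rewrite (metric_sym y x); lra.
Qed.

(** Moving the center by [r] costs no more than enlarging the radius by [r];
    hence Lipschitz continuity in the radius passes to the center. *)
Lemma lipschitz_profile_center nu (K : R) x y t : 0 <= t ->
  (forall w r s, 0 <= r -> 0 <= s ->
    `|profile nu w r - profile nu w s| <= K * `|r - s|) ->
  `|profile nu x t - profile nu y t| <= K * mdist x y.
Proof.
move=> t0 lip; have d0 := mdist_ge0 x y.
have aux u v : profile nu u t - profile nu v t <= K * mdist u v.
  have := lip v (t + mdist u v) t; rewrite addrAC subrr add0r.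
  rewrite (ger0_norm (mdist_ge0 _ _)) => /(_ (addr_ge0 t0 (mdist_ge0 _ _)) t0).
  have := profile_shift nu t (lexx (mdist u v)); rewrite ler_norml; lra.
have := aux x y; have := aux y x; rewrite (metric_sym y x) ler_norml; lra.
Qed.

(** An atom at [x] would make every profile centered elsewhere jump, at the
    radius given by the distance of its center to [x]. *)
Lemma lipschitz_no_atom nu x y : lipschitz_profiles nu -> x != y ->
  profile nu x 0 = 0.
Proof.
move=> [K K0 lip] xy; set a := profile nu x 0.
have a0 : 0 <= a by rewrite /a fine_ge0.
apply/eqP; rewrite eq_le a0 andbT leNgt; apply/negP => ap.
have s0 : 0 < mdist y x by rewrite mdist_gt0 eq_sym.
pose s := mdist y x; pose h := Num.min s (a / (2 * K)).
have h0 : 0 < h by rewrite lt_min s0 divr_gt0// mulr_gt0.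
have hs : h <= s by rewrite ge_min lexx.
have ha : K * h <= a / 2.
  have : h <= a / (2 * K) by rewrite ge_min lexx orbT.
  rewrite ler_pdivlMr ?mulr_gt0//; lra.
have := lip y s (s - h) (ltW s0).
rewrite subr_ge0 => /(_ hs).
rewrite opprB addrCA subrr addr0 (ger0_norm (ltW h0)).
have jump : profile nu y (s - h) + a <= profile nu y s.
  rewrite -lee_fin EFinD -!profileE -measureU; last 3 first.
  - exact: measurable_cball.
  - exact: measurable_cball.
  - apply/seteqP; split=> // z; rewrite /cball/= => -[yz xz].
    have := metric_triangle y z x; rewrite (metric_sym z x) -/s; lra.
  apply: le_measure; rewrite ?inE.
  - by apply: measurableU; exact: measurable_cball.
  - exact: measurable_cball.
  move=> z; rewrite /cball/= => -[] H; first lra.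
  have := metric_triangle y x z; rewrite -/s; lra.
rewrite ler_norml; lra.
Qed.

(** Both sides vanish, unless the space is a single point and both are one. *)
Lemma profile0_eq nu1 nu2 x :
  lipschitz_profiles nu1 -> lipschitz_profiles nu2 ->
  profile nu1 x 0 = profile nu2 x 0.
Proof.
move=> l1 l2; have [[y xy]|H] := pselect (exists y, x != y).
  by rewrite (lipschitz_no_atom l1 xy) (lipschitz_no_atom l2 xy).
have xT : cball x 0 = setT.
  apply/seteqP; split=> // y _; have [->|xy] := eqVneq x y.
    by rewrite /cball/= mdistxx.
  by exfalso; apply: H; exists y.
apply: EFin_inj; rewrite -!profileE xT.
exact: etrans (probability_setT nu1) (esym (probability_setT nu2)).
Qed.

Lemma msupport_gt0 nu x (U : set Omega) :
  msupport nu x -> open U -> U x -> (0 < nu U)%E.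
Proof.
move=> sx oU Ux; have /sx[y [Sy Uy]] : nbhs x U by exact: open_nbhs_nbhs.
exact: Sy.
Qed.

Lemma closed_msupport nu : closed (msupport nu).
Proof. exact: closed_closure. Qed.

Lemma dense_seq : separable Omega -> exists u : nat -> Omega, dense (range u).
Proof.
move=> [S [/pfcard_geP[S0|[f]] dS]].
  have [] := dS setT; first by exists point.
    exact: openT.
  by move=> x; rewrite S0 => -[].
exists f; suff -> : range f = S by [].
by apply/seteqP; split=> [_ [n _ <-]|s /(@surj _ _ _ _ f)[n _ <-]];
  [exact: funS|exists n].
Qed.

(** The complement of the support is a union of null balls whose centers and
    radii come from countable sets. *)
Lemma measure_msupportC nu : separable Omega -> nu (~` msupport nu) = 0%E.
Proof.
move=> /dense_seq[u du].
pose F (k m : nat) : set (borel Omega) :=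
  [set x | nu (ball (u k) m.+1%:R^-1 : set Omega) = 0%E /\
           ball (u k) m.+1%:R^-1 x].
have mF : measurable (~` msupport nu : set (borel Omega)).
  apply: measurableC; apply: closed_borel; exact: closed_msupport.
have [+ _] := @negligibleP _ _ _ nu _ mF; apply.
have nF : nu.-negligible (\bigcup_k \bigcup_m F k m).
  apply: negligible_bigcup => k; apply: negligible_bigcup => m.
  have mB : measurable (ball (u k) m.+1%:R^-1 : set (borel Omega)).
    by apply: open_borel; exact: open_mball.
  have [B0|B0] := pselect (nu (ball (u k) m.+1%:R^-1 : set Omega) = 0%E).
    by exists (ball (u k) m.+1%:R^-1 : set Omega); split=> // x [].
  by exists set0; split=> // x [].
apply: (negligibleS _ nF) => x sx.
have [U [oU Ux U0]] : exists U : set Omega, [/\ open U, U x & nu U = 0%E].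
  apply: contrapT => H; apply: sx; apply: subset_closure => U oU Ux.
  by rewrite lt0e measure_ge0 andbT; apply/eqP => U0; apply: H; exists U.
have /nbhs_ballP[e /= e0 eU] : nbhs x U by exact: open_nbhs_nbhs.
have [|m] := @ltr_add_invr R 0 (e / 2); first by rewrite divr_gt0.
rewrite add0r => me.
have [] := du (ball x m.+1%:R^-1); [|exact: open_mball|].
  by exists x; rewrite ballEmdist/= mdistxx.
move=> y [xy [k _ ky]]; move: xy; rewrite -ky ballEmdist/= => xk.
exists k => //; exists m => //; split; last by rewrite ballEmdist/= metric_sym.
apply/eqP; rewrite -measure_le0 -U0; apply: le_measure; rewrite ?inE.
- by apply: open_borel; exact: open_mball.
- exact: open_borel.
- move=> z zk; apply: eU; move: zk; rewrite !ballEmdist/= => zk.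
  apply: le_lt_trans (metric_triangle x (u k) z) _.
  by rewrite (splitr e) ltrD// ?(lt_trans xk)// (lt_trans zk).
Qed.

Hypothesis entropy : entropy_condition Omega.

(** The product [e * log N(e)] is infinite when [N(e)] is, so that its finite
    limit forces [N(e)] to be finite for small [e]. *)
Lemma entropy_totally_bounded r : 0 < r ->
  exists s : seq Omega, [set: Omega] `<=` \bigcup_(x in [set` s]) ball x r.
Proof.
move=> r0.
have fcov : \forall e \near 0^'+, (covering_number Omega e < +oo)%E.
  move/fine_cvgP : entropy => [+ _].
  have pos : \forall e \near (0 : R)^'+, 0 < e by exact: nbhs_right_gt.
  apply: filterS2 pos => e e0; case: (covering_number Omega e) => [c| |] //=.
  by rewrite ltry.
  by rewrite gt0_muley.
have small : \forall e \near (0 : R)^'+, e < r by exact: nbhs_right_lt.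
have [e [ecov er]] : exists e, (covering_number Omega e < +oo)%E /\ e < r.
  by near (0 : R)^'+ => e; exists e; split; near: e.
move: ecov => /ereal_inf_lt[_ [s sc _] _]; exists s => x xT.
have [y sy xy] := sc x xT; exists y => //.
move: xy; rewrite !ballEmdist/= => /lt_trans; exact.
Unshelve. all: by end_near. Qed.

Lemma bounded_mdist : exists D : R, forall x y, mdist x y <= D.
Proof.
have [s sc] := entropy_totally_bounded ltr01.
exists (\sum_(u <- s) \sum_(v <- s) mdist u v + 2) => x y.
have [u us] := sc x I; rewrite ballEmdist/= => ux.
have [v vs] := sc y I; rewrite ballEmdist/= => vy.
have uv : mdist u v <= \sum_(u <- s) \sum_(v <- s) mdist u v.
  rewrite (big_rem u us)/= (big_rem v vs)/= -addrA lerDl addr_ge0//.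
    by apply: sumr_ge0 => ? _; exact: mdist_ge0.
  by apply: sumr_ge0 => ? _; apply: sumr_ge0 => ? _; exact: mdist_ge0.
have := metric_triangle x u y; have := metric_triangle u v y.
rewrite (metric_sym x u); lra.
Qed.

End geometry.

(** * Identification under strong negative type *)

Section nonmeasurable_integrands.
Context d {T : measurableType d} {R : realType} (nu : probability T R).
Import HBNNSimple.

(** Truncating a simple function below [f] to [S] gives one below [g] with the
    same integral. The comparison is meant for inner integrals of the distance,
    whose measurability in the outer variable would take a separate proof. *)
Lemma ge0_le_integral_full (S : set T) (f g : T -> \bar R) :
  measurable S -> nu (~` S) = 0%E ->
  (forall x, (0 <= f x)%E) -> (forall x, (0 <= g x)%E) ->
  (forall x, S x -> (f x <= g x)%E) ->
  (\int[nu]_x f x <= \int[nu]_x g x)%E.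
Proof.
move=> mS S0 f0 g0 fg; rewrite !ge0_integralTE//.
apply: ge_ereal_sup => _ [h hf <-]; apply: ereal_sup_ubound.
exists (proj_nnsfun h mS) => [x|].
  rewrite /= mindicE; case: (boolP (x \in S)) => xS; last by rewrite mulr0.
  by rewrite mulr1 (le_trans (hf x))// fg//; rewrite inE in xS.
rewrite -!integralT_nnsfun; apply: ge0_ae_eq_integral => //=.
- by apply/measurable_EFinP; exact: (measurable_funPT (proj_nnsfun h mS)).
- by apply/measurable_EFinP; exact: measurable_funPT.
- by move=> x _; rewrite lee_fin mulr_ge0// mindicE.
- by move=> x _; rewrite lee_fin.
exists (~` S); split; [exact: measurableC|exact: S0|].
move=> x H xS; apply: H => _; rewrite /= mindicE mem_set// mulr1.
by [].
Qed.

Lemma ge0_eq_integral_full (S : set T) (f g : T -> \bar R) :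
  measurable S -> nu (~` S) = 0%E ->
  (forall x, (0 <= f x)%E) -> (forall x, (0 <= g x)%E) ->
  (forall x, S x -> f x = g x) ->
  (\int[nu]_x f x = \int[nu]_x g x)%E.
Proof.
move=> mS S0 f0 g0 fg; apply/eqP; rewrite eq_le.
by apply/andP; split; apply: (ge0_le_integral_full mS) => // x Sx; rewrite fg.
Qed.

Lemma ge0_integral_le_cst (f : T -> \bar R) (c : R) :
  (forall x, (0 <= f x)%E) -> (forall x, (f x <= c%:E)%E) ->
  (\int[nu]_x f x <= c%:E)%E.
Proof.
move=> f0 fc; have c0 : (0 <= c%:E)%E by exact: le_trans (f0 point) (fc point).
apply: (@le_trans _ _ (\int[nu]_x cst c%:E x)%E).
  by apply: (@ge0_le_integral_full setT) => //; rewrite setCT measure0.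
rewrite integral_cst// [X in (_ * X)%E](probability_setT nu) mule1.
exact: lexx.
Qed.

End nonmeasurable_integrands.

Section identification.
Context {R : realType} (Omega : pmetricType R).
Implicit Types (nu : probability (borel Omega) R) (x y w : Omega) (r s t : R).

Lemma measurable_mdist x :
  measurable_fun [set: borel Omega] (mdist x : borel Omega -> R).
Proof.
apply: (measurability _ (RGenOInfty.measurableE R)) => _ [_ [t ->] <-].
rewrite setTI (_ : _ @^-1` _ = ~` cball x t); last first.
  by apply/seteqP; split=> y; rewrite /cball/= in_itv/= andbT ltNge => /negP.
by apply: measurableC; exact: measurable_cball.
Qed.

(** The profile at [x] is the distribution function of the distance to [x], and
    a distribution function determines its law. *)
Lemma eq_profile_integral nu1 nu2 x (phi : R -> \bar R) :
  (forall t, 0 <= t -> profile nu1 x t = profile nu2 x t) ->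
  measurable_fun setT phi -> (forall s, (0 <= phi s)%E) ->
  (\int[nu1]_y phi (mdist x y) = \int[nu2]_y phi (mdist x y))%E.
Proof.
move=> eqF mphi phi0; have mx := measurable_mdist x.
rewrite -[LHS](ge0_integral_pushforward mx nu1 measurableT mphi)//.
rewrite -[RHS](ge0_integral_pushforward mx nu2 measurableT mphi)//.
apply: eq_measure_integral => A mA _.
apply: (@measure_unique _ _ _ (@RGenOInfty.G R)
  (fun k => `](- k%:R), +oo[%classic) (RGenOInfty.measurableE R)) => //.
- move=> _ _ [a ->] [b ->]; exists (Num.max a b).
  apply/seteqP; split=> z /=; rewrite !in_itv/= !andbT gt_max.
    by case=> -> ->.
  by case/andP.
- by move=> k; exists (- k%:R).
- apply/seteqP; split=> // z _.
  have zk := archimedean.Num.Theory.archi_boundP (normr_ge0 z).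
  exists (Num.bound `|z|) => //=; rewrite in_itv/= andbT.
  by rewrite ltrNl (le_lt_trans _ zk)// -normrN ler_norm.
- move=> _ [t ->].
  change (nu1 (mdist x @^-1` `]t, +oo[) = nu2 (mdist x @^-1` `]t, +oo[)).
  have E : mdist x @^-1` `]t, +oo[ = ~` cball x t.
    by apply/seteqP; split=> y; rewrite /cball/= in_itv/= andbT ltNge => /negP.
  have [t0|t0] := leP 0 t.
    rewrite E !probability_setC; [|exact: measurable_cball..].
    by rewrite !profileE eqF.
  have -> : mdist x @^-1` `]t, +oo[ = setT.
    apply/seteqP; split=> // y _ /=; rewrite in_itv/= andbT.
    exact: lt_le_trans (mdist_ge0 _ _).
  exact: etrans (probability_setT nu1) (esym (probability_setT nu2)).
- move=> k; change (nu1 (mdist x @^-1` `](- k%:R)%R, +oo[) < +oo)%E.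
  apply: le_lt_trans (ltry 1); apply: probability_le1.
  by rewrite -[X in measurable X]setTI; apply: mx.
Qed.


(** If [S] carries both measures, then the inner integrals of the energies agree
    wherever the outer measures live, so that the energy distance vanishes.
    First moments are finite because the entropy condition bounds the metric. *)
Lemma strong_negative_type_same_law nu1 nu2 :
  entropy_condition Omega -> power_strong_negative_type Omega ->
  (exists S : set Omega, [/\ measurable (S : set (borel Omega)),
     nu1 (~` S) = 0%E, nu2 (~` S) = 0%E &
     forall x t, S x -> 0 <= t -> profile nu1 x t = profile nu2 x t]) ->
  same_law nu1 nu2.
Proof.
move=> ent [alpha a0 [_ sn]] [S [mS S1 S2 eqF]].
have [D dD] := bounded_mdist ent.
have D0 : 0 <= D := le_trans (mdist_ge0 point point) (dD point point).
have rho0 x y : (0 <= (mdist x y `^ alpha)%:E)%E by rewrite lee_fin powR_ge0.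
have rhoD x y : ((mdist x y `^ alpha)%:E <= (D `^ alpha)%:E)%E.
  by rewrite lee_fin ge0_ler_powR ?(ltW a0)// nnegrE ?mdist_ge0.
pose f nu x := (\int[nu]_y (mdist x y `^ alpha)%:E)%E.
have f0 nu x : (0 <= f nu x)%E by apply: integral_ge0 => y _.
have fD nu x : (f nu x <= (D `^ alpha)%:E)%E by exact: ge0_integral_le_cst.
have ffm nu : finite_first_moment (fun x y => mdist x y `^ alpha) nu.
  by exists point; exact: le_lt_trans (fD nu point) (ltry _).
have f12 x : S x -> f nu1 x = f nu2 x.
  move=> Sx; apply: (@eq_profile_integral nu1 nu2 x (fun s => (s `^ alpha)%:E)).
  - by move=> t; exact: eqF.
  - by apply/measurable_EFinP; exact: measurable_powR.
  - by move=> s; rewrite lee_fin powR_ge0.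
have fin nu nu' : (\int[nu]_x f nu' x)%E \is a fin_num.
  rewrite ge0_fin_numE; last by apply: integral_ge0 => y _.
  by apply: le_lt_trans (ltry (D `^ alpha)); exact: ge0_integral_le_cst.
have energy0 : (\int[nu1]_x f nu1 x - \int[nu1]_x f nu2 x
    - \int[nu2]_x f nu1 x + \int[nu2]_x f nu2 x = 0)%E.
  rewrite -(ge0_eq_integral_full mS S1 (f0 nu1) (f0 nu2) f12).
  rewrite -(ge0_eq_integral_full mS S2 (f0 nu1) (f0 nu2) f12).
  by rewrite subee// sub0e addeC subee.
exact: (sn nu1 nu2 (ffm nu1) (ffm nu2) energy0).
Qed.

(** Continuity in the radius makes agreement of two profiles a closed condition;
    it is phrased by approximation to fit suprema and infima of radii. *)
Lemma profile_eq_limit nu1 nu2 x a :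
  lipschitz_profiles nu1 -> lipschitz_profiles nu2 -> 0 <= a ->
  (forall e, 0 < e -> exists s, [/\ 0 <= s, `|s - a| <= e &
     profile nu1 x s = profile nu2 x s]) ->
  profile nu1 x a = profile nu2 x a.
Proof.
move=> [K1 K10 l1] [K2 K20 l2] a0 H; apply/eqP; rewrite -subr_eq0 -normr_le0.
apply/ler_addgt0Pr => e e0; rewrite add0r.
have [s [s0 sa eqs]] := H (e / (K1 + K2)) (divr_gt0 e0 (addr_gt0 K10 K20)).
have := l1 x s a s0 a0; have := l2 x s a s0 a0; rewrite eqs.
have : (K1 + K2) * `|s - a| <= e by rewrite -ler_pdivlMl ?addr_gt0// mulrC.
rewrite !ler_norml; lra.
Qed.

(** Between two consecutive distances from [x] to the support of [nu1] the
    profile of [nu1] is constant; agreement at the two ends and monotonicity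
    force the profile of [nu2] to be constant there, too. *)
Lemma profile_eq_extend nu1 nu2 x : separable Omega ->
  lipschitz_profiles nu1 -> lipschitz_profiles nu2 -> msupport nu1 x ->
  (forall y, msupport nu1 y ->
     profile nu1 x (mdist x y) = profile nu2 x (mdist x y)) ->
  forall t, 0 <= t -> profile nu1 x t = profile nu2 x t.
Proof.
move=> sep l1 l2 sx eqF t t0.
pose S : set R := [set mdist x y | y in msupport nu1].
have S0 : S 0 by exists x => //; exact: mdistxx.
have Sge0 s : S s -> 0 <= s by move=> [y _ <-]; exact: mdist_ge0.
have eqS s : S s -> profile nu1 x s = profile nu2 x s.
  by move=> [y sy <-]; exact: eqF.
(* only distances within the support matter for the profile of nu1 *)
have flat (C : set Omega) s : measurable (C : set (borel Omega)) ->
    (forall y, msupport nu1 y -> C y -> mdist x y <= s) ->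
    (nu1 C <= (profile nu1 x s)%:E)%E.
  move=> mC H; rewrite -profileE -[leRHS]adde0.
  rewrite -(measure_msupportC nu1 sep).
  have mN : measurable (~` msupport nu1 : set (borel Omega)).
    by apply: measurableC; apply: closed_borel; exact: closed_msupport.
  apply: le_trans (measureU2 nu1 (measurable_cball x s) mN).
  apply: le_measure; rewrite ?inE//.
    by apply: measurableU => //; exact: measurable_cball.
  move=> y Cy; have [sy|] := pselect (msupport nu1 y); last by right.
  by left; exact: H.
have flat_cball r s : (forall u, S u -> u <= r -> u <= s) ->
    profile nu1 x r <= profile nu1 x s.
  move=> H; rewrite -lee_fin -[leLHS]profileE; apply: flat.
    exact: measurable_cball.
  by move=> y sy; apply: H; exists y.
pose A := [set s | S s /\ s <= t]; pose B := [set s | S s /\ t <= s].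
have A0 : A 0 by [].
have hA : has_sup A by split; [exists 0|exists t => s []].
have a0 : 0 <= sup A by apply: ub_le_sup => //; exact: hA.2.
have ta : sup A <= t by apply: ge_sup => [|s []//]; exists 0.
have eqa : profile nu1 x (sup A) = profile nu2 x (sup A).
  apply: profile_eq_limit => // e e0.
  have [s [Ss st] sa] := sup_adherent e0 hA.
  exists s; split; [exact: Sge0| |exact: eqS].
  have sA : s <= sup A by apply: ub_le_sup => //; exact: hA.2.
  by rewrite ler_norml; lra.
have flata : profile nu1 x t <= profile nu1 x (sup A).
  by apply: flat_cball => u Su ut; apply: ub_le_sup; [exact: hA.2|].
have mono1 := @profile_homo _ _ nu1 x; have mono2 := @profile_homo _ _ nu2 x.
have low : profile nu1 x t <= profile nu2 x t.
  by apply: (le_trans flata); rewrite eqa; exact: mono2.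
apply/eqP; rewrite eq_le low/=.
(* beyond the farthest support point both profiles are equal to one *)
have [[b0 Bb0]|nB] := pselect (exists b, B b); last first.
  apply: le_trans (profile_le1 _ _ _) _.
  rewrite -lee_fin -(probability_setT nu1); apply: flat => // y sy _.
  by apply/ltW; rewrite ltNge; apply/negP => ty; apply: nB; exists (mdist x y);
    split => //; exists y.
have hB : has_inf B by split; [exists b0|exists t => s []].
have tb : t <= inf B by apply: lb_le_inf => [|s []//]; exists b0.
have bge0 := le_trans t0 tb.
have eqb : profile nu1 x (inf B) = profile nu2 x (inf B).
  apply: profile_eq_limit => // e e0.
  have [s [Ss st] sb] := inf_adherent e0 hB.
  exists s; split; [exact: Sge0| |exact: eqS].
  have sB : inf B <= s by apply: ge_inf => //; exact: hB.2.
  by rewrite ler_norml; lra.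
apply: (le_trans (mono2 _ _ tb)); rewrite -eqb.
apply/ler_addgt0Pr => e e0; have [K K0 lipK] := l1.
pose s := Num.max t (inf B - e / K).
have flatb : profile nu1 x s <= profile nu1 x t.
  apply: flat_cball => u Su; rewrite le_max => /orP[//|ub].
  rewrite leNgt; apply/negP => tu.
  have : inf B <= u by apply: ge_inf; [exact: hB.2|split=> //; exact: ltW].
  have := divr_gt0 e0 K0; lra.
have s0 : 0 <= s by rewrite le_max t0.
have sb : s <= inf B by rewrite ge_max tb gerBl divr_ge0// ltW.
have : K * (inf B - s) <= e.
  rewrite -ler_pdivlMl// mulrC lerBlDr addrC -lerBlDr.
  by rewrite le_max lexx orbT.
have := lipK x (inf B) s bge0 s0.
rewrite (@ger0_norm _ (inf B - s)) ?subr_ge0// ler_norml; lra.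
Qed.

End identification.

(** * Identification under the doubling condition *)

Section doubling_balls.
Context {R : realType} (Omega : pmetricType R).
Implicit Types (nu : probability (borel Omega) R) (x y w : Omega) (r s t : R).

(** Greedy selection along a finite cover by [r]-balls: every chosen point
    removes the ball of radius [2 * r] around it, so that the chosen [r]-balls
    are disjoint, while their [2 * r]-enlargements cover [A]; [E] is the union
    of the chosen [r]-balls. *)
Lemma finite_packing nu1 nu2 (C r : R) (s : seq Omega) (A : set Omega) :
  0 <= C -> measurable (A : set (borel Omega)) ->
  A `<=` \bigcup_(x in [set` s]) ball x r ->
  (forall x, A x -> profile nu1 x (2 * r) <= C * profile nu1 x r) ->
  (forall x, A x -> profile nu1 x r = profile nu2 x r) ->
  exists E : set Omega, [/\ closed E, E `<=` \bigcup_(x in A) cball x r,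
    nu1 E = nu2 E & (nu1 A <= C%:E * nu1 E)%E].
Proof.
move=> C0; elim: s A => [|c s IH] A mA As dbl eqF.
  have A0 : A = set0 by apply/seteqP; split=> // x /As[].
  exists set0; split; [exact: closed0|by []|by rewrite !measure0|].
  by rewrite A0 !measure0 mule0.
have [[x [Ax xc]]|nx] := pselect (exists x, A x /\ ball c r x); last first.
  apply: IH => // x Ax; have [y] := As x Ax.
  rewrite /= inE => /orP[/eqP -> xc|ys xy]; last by exists y.
  by exfalso; apply: nx; exists x.
have mB t := measurable_cball x t.
have [||||E [cE EA eqE AE]] := IH (A `\` cball x (2 * r)).
- exact: measurableD.
- move=> y [Ay xy]; have [z] := As y Ay.
  rewrite /= inE => /orP[/eqP -> zy|zs zy]; last by exists z.
  exfalso; apply: xy; move: xc zy; rewrite !ballEmdist/cball/= => cx cy.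
  have := metric_triangle x c y; rewrite (metric_sym x c); lra.
- by move=> y [Ay _]; exact: dbl.
- by move=> y [Ay _]; exact: eqF.
have mE : measurable (E : set (borel Omega)) by exact: closed_borel.
have disj : cball x r `&` E = set0.
  apply/seteqP; split=> // z [xz /EA[y [Ay xy] yz]]; apply: xy.
  move: xz yz; rewrite /cball/= => xz yz.
  have := metric_triangle x z y; rewrite (metric_sym z y); lra.
have addE nu : nu (cball x r `|` E) = (nu (cball x r) + nu E)%E.
  exact: measureU.
exists (cball x r `|` E); split.
- by apply: closedU => //; exact: closed_cball.
- move=> z [xz|/EA[y [Ay _] yz]]; [by exists x|by exists y].
- by rewrite !addE eqE !profileE eqF.
- rewrite addE ge0_muleDr ?measure_ge0//.
  apply: (@le_trans _ _
    (nu1 (cball x (2 * r)) + nu1 (A `\` cball x (2 * r)))%E).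
    apply: le_trans (measureU2 nu1 (mB _) (measurableD mA (mB _))).
    apply: le_measure; rewrite ?inE//.
      by apply: measurableU => //; exact: measurableD.
    move=> y Ay; have [?|?] := pselect (cball x (2 * r) y); first by left.
    by right.
  by apply: leeD => //; rewrite !profileE -EFinM lee_fin; exact: dbl.
Qed.

(** The doubling condition speaks of open balls; two doublings absorb the
    passage to closed ones, which squares the constant. *)
Lemma doubling_profile nu : doubling nu ->
  exists2 C : R, 1 <= C & forall x, msupport nu x -> exists2 e : R, 0 < e &
    forall r, 0 < r -> r < e -> profile nu x (2 * r) <= C * profile nu x r.
Proof.
move=> [L dL]; pose M := Num.max 1 (L + 1).
have M1 : 1 <= M by rewrite le_max lexx.
have M0 : 0 <= M by exact: le_trans M1.
exists (M * M) => [|x sx]; first by rewrite -[1]mulr1 ler_pM.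
pose b r := fine (nu (ball x r)).
have bE r : nu (ball x r) = (b r)%:E.
  by rewrite fineK// fin_num_measure//; apply: open_borel; exact: open_mball.
have : (limf_esup (fun r : R => (b (2 * r)%R / b r)%:E) (0^'+)%R
    < (L + 1)%:E)%E.
  by apply: le_lt_trans (dL x sx) _; rewrite lte_fin ltrDl.
rewrite limf_esupE => /ereal_inf_lt[_ [V V0 <-] supV].
have [e /= e0 eV] := V0.
have step r : 0 < r -> r < e -> b (2 * r) <= M * b r.
  move=> r0 re; have br : 0 < b r.
    rewrite -lte_fin -bE; apply: (msupport_gt0 sx (open_mball _ _)).
    by rewrite ballEmdist/= mdistxx.
  rewrite -ler_pdivrMr// le_max; apply/orP; right; rewrite -lee_fin.
  apply: (@le_trans _ _ (ereal_sup [set (b (2 * r)%R / b r)%:E | r in V])).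
    apply: ereal_sup_ubound; exists r => //; apply: eV => //=.
    by rewrite sub0r normrN gtr0_norm.
  exact: ltW.
exists (e / 2) => [|r r0 re]; first by rewrite divr_gt0.
have r20 : 0 < 2 * r by rewrite mulr_gt0.
have sub1 : profile nu x (2 * r) <= b (2 * (2 * r)).
  rewrite -lee_fin -bE -profileE; apply: le_measure; rewrite ?inE.
  - exact: measurable_cball.
  - by apply: open_borel; exact: open_mball.
  - by move=> y; rewrite ballEmdist /cball/=; lra.
have sub2 : b r <= profile nu x r.
  rewrite -lee_fin -bE -profileE; apply: le_measure; rewrite ?inE.
  - by apply: open_borel; exact: open_mball.
  - exact: measurable_cball.
  - by move=> y; rewrite ballEmdist /cball/=; lra.
apply: (le_trans sub1); apply: (le_trans (step _ r20 _)); first lra.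
rewrite -mulrA ler_wpM2l//; apply: (le_trans (step _ r0 _)); first lra.
by rewrite ler_wpM2l.
Qed.

Lemma closed_lipschitz_ge0 (g : Omega -> R) (K : R) : 0 < K ->
  (forall x y, `|g x - g y| <= K * mdist x y) -> closed [set x | 0 <= g x].
Proof.
move=> K0 lip; rewrite -[X in closed X]setCK; apply: open_closedC.
rewrite openE => x /= /negP; rewrite -ltNge => gx.
apply/nbhs_ballP; exists (- g x / K) => /=; first by rewrite divr_gt0 ?oppr_gt0.
move=> y; rewrite ballEmdist/= ltr_pdivlMr// => xy; apply/negP; rewrite -ltNge.
have := lip x y; rewrite ler_norml; lra.
Qed.

Lemma closed_ball_sub (U : set Omega) r : closed [set x | ball x r `<=` U].
Proof.
rewrite -[X in closed X]setCK; apply: open_closedC.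
rewrite openE => x /= xU.
have [y xy yU] : exists2 y, ball x r y & ~ U y.
  apply: contrapT => H; apply: xU => y xy; apply: contrapT => yU.
  by apply: H; exists y.
have : nbhs x (ball y r).
  by apply: open_nbhs_nbhs; split; [exact: open_mball|exact: ball_sym].
by apply: filterS => z yz zU; apply: yU; apply: zU; exact: ball_sym.
Qed.

End doubling_balls.

Section doubling_comparison.
Context {R : realType} (Omega : pmetricType R).
Implicit Types (x y w : Omega) (r s t : R).
Variables nu1 nu2 : probability (borel Omega) R.
Hypothesis entropy : entropy_condition Omega.
Hypothesis sep : separable Omega.
Hypothesis lip1 : lipschitz_profiles nu1.
Hypothesis eqF : forall x r, msupport nu1 x -> 0 <= r ->
  profile nu1 x r = profile nu2 x r.

Let m1 (A : set Omega) : R := fine (nu1 A).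
Let m2 (A : set Omega) : R := fine (nu2 A).
Let m1E (A : set Omega) : measurable (A : set (borel Omega)) ->
  nu1 A = (m1 A)%:E.
Proof. by move=> mA; rewrite fineK// fin_num_measure. Qed.
Let m2E (A : set Omega) : measurable (A : set (borel Omega)) ->
  nu2 A = (m2 A)%:E.
Proof. by move=> mA; rewrite fineK// fin_num_measure. Qed.

Variable C : R.
Hypothesis C1 : 1 <= C.
Hypothesis dblC : forall x, msupport nu1 x -> exists2 e : R, 0 < e &
  forall r, 0 < r -> r < e -> profile nu1 x (2 * r) <= C * profile nu1 x r.

Let mS : measurable (msupport nu1 : set (borel Omega)).
Proof. by apply: closed_borel; exact: closed_msupport. Qed.

Let closed_doubling_at r : 0 <= r ->
  closed [set x | profile nu1 x (2 * r) <= C * profile nu1 x r].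
Proof.
move=> r0; have [K K0 lip] := lip1.
rewrite (_ : [set x | _] =
    [set x | 0 <= C * profile nu1 x r - profile nu1 x (2 * r)]); last first.
  by apply/seteqP; split=> x /=; rewrite subr_ge0.
have C0 : 0 < C by apply: lt_le_trans C1.
apply: (@closed_lipschitz_ge0 _ _ _ (C * K + K)) => [|x y].
  by rewrite addr_gt0// mulr_gt0.
have l1 := lipschitz_profile_center x y r0 lip.
have l2 := lipschitz_profile_center x y (mulr_ge0 (ler0n _ 2) r0) lip.
have : `|C * profile nu1 x r - C * profile nu1 y r| <= C * K * mdist x y.
  by rewrite -mulrBr normrM gtr0_norm// -mulrA ler_pM2l.
move: l2; rewrite !ler_norml mulrDl; lra.
Qed.

(** As the scale decreases, the points at which the doubling inequality holds
    at all smaller scales [k.+1%:R^-1] exhaust the support; one scale therefore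
    serves at least half of the mass of [U]. *)
Lemma half_mass_packing (U : set Omega) : open U ->
  exists E : set Omega, [/\ closed E, E `<=` U, m1 E = m2 E &
    m1 U <= 2 * C * m1 E].
Proof.
move=> oU; have mU : measurable (U : set (borel Omega)) by exact: open_borel.
have [U0|U0] := eqVneq (m1 U) 0.
  exists set0; split; [exact: closed0|by []| |].
    by rewrite /m1 /m2 !measure0.
  by rewrite U0 /m1 measure0 mulr0.
pose rho k : R := k.+1%:R^-1.
have rho0 k : 0 < rho k by rewrite invr_gt0.
pose G k : set Omega := [set x | ball x (2 * rho k) `<=` U] `&`
  [set x | profile nu1 x (2 * rho k) <= C * profile nu1 x (rho k)].
have mG k : measurable (G k : set (borel Omega)).
  apply: measurableI; apply: closed_borel; first exact: closed_ball_sub.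
  by apply: closed_doubling_at; exact: ltW.
pose H m : set (borel Omega) :=
  msupport nu1 `&` \bigcap_(k in [set k | (m <= k)%N]) G k.
have mH m : measurable (H m).
  apply: measurableI => //; apply: bigcap_measurable => [|k _]; last exact: mG.
  by exists m => /=.
have H_nd : nondecreasing_seq H.
  move=> m n mn; apply/subsetPset => x [sx Gx]; split=> // k /= nk.
  by apply: Gx => /=; exact: leq_trans nk.
have HU : msupport nu1 `&` U `<=` \bigcup_m H m.
  move=> x [sx Ux].
  have /nbhs_ballP[e1 /= e10 e1U] : nbhs x U by exact: open_nbhs_nbhs.
  have [e2 e20 dbl2] := dblC sx.
  have e0 : 0 < Num.min (e1 / 2) e2 by rewrite lt_min e20 divr_gt0.
  have [m] := ltr_add_invr e0; rewrite add0r lt_min => /andP[me1 me2].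
  exists m => //; split=> // k /= mk.
  have km : rho k <= rho m by rewrite lef_pV2 ?posrE// ler_nat.
  split=> /=.
    apply: subset_trans e1U; apply: le_ball.
    by rewrite -ler_pdivlMl// mulrC (le_trans km)// ltW.
  by apply: dbl2 => //; exact: le_lt_trans me2.
have mbH : measurable (\bigcup_m H m) by exact: bigcup_measurable.
have cvgH : (m1 \o H) n @[n --> \oo] --> m1 (\bigcup_m H m).
  apply: fine_cvg; rewrite -m1E//.
  exact: (nondecreasing_cvg_mu (mu := nu1) mH mbH H_nd).
have massH : m1 U <= m1 (\bigcup_m H m).
  rewrite -lee_fin -!m1E// -[leRHS]adde0 -(measure_msupportC nu1 sep).
  have mN := measurableC mS.
  apply: (@le_trans _ _ (nu1 ((\bigcup_m H m) `|` ~` msupport nu1))).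
    apply: le_measure; rewrite ?inE//; first exact: measurableU.
    move=> x Ux; have [sx|] := pselect (msupport nu1 x); last by right.
    by left; exact: HU.
  exact: measureU2.
have Upos : 0 < m1 U by rewrite lt0r U0 fine_ge0.
have [m Um] : exists m, m1 U / 2 < m1 (H m).
  have hlt : m1 U / 2 < m1 (\bigcup_m H m) by lra.
  have /(_ _ _ hlt)/filter_ex[m Hm] := cvgr_gt _ cvgH.
  by exists m.
have [s sc] := entropy_totally_bounded entropy (rho0 m).
have C0 : 0 <= C by exact: le_trans C1.
have [||||E [cE EH eqE mE]] := @finite_packing _ _ nu1 nu2 C (rho m) s (H m) C0.
- exact: mH.
- by move=> x _; exact: sc.
- by move=> x [_ /(_ m (leqnn m))[]].
- by move=> x [sx _]; apply: eqF => //; exact: ltW.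
exists E; split=> //; last 2 first.
- by rewrite /m1 /m2 eqE.
- have mbE : measurable (E : set (borel Omega)) by exact: closed_borel.
  move: mE; rewrite !m1E// -EFinM lee_fin; lra.
move=> z /EH[x [_ /(_ m (leqnn m))[/= xU _]] xz]; apply: xU.
rewrite ballEmdist/=; apply: le_lt_trans xz _.
by have := rho0 m; lra.
Qed.

(** Removing a packing leaves [m1 V - m2 V] unchanged and shrinks [m1 V] by the
    fixed factor [q]; iteration shows that the difference is not positive. *)
Lemma open_measure_le (U : set Omega) : open U -> m1 U <= m2 U.
Proof.
pose q := 1 - (2 * C)^-1.
have C20 : 0 < 2 * C by rewrite mulr_gt0// (lt_le_trans _ C1).
have q0 : 0 <= q.
  rewrite subr_ge0 invf_le1//; have := C1; lra.
have q1 : q < 1 by rewrite gtrBl invr_gt0.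
have iter k : forall V : set Omega, open V -> m1 V - m2 V <= q ^+ k * m1 V.
  elim: k => [V _|k IH V oV]; first by rewrite expr0 mul1r gerBl fine_ge0.
  have [E [cE EV eqE VE]] := half_mass_packing oV.
  have mE : measurable (E : set (borel Omega)) by exact: closed_borel.
  have mV : measurable (V : set (borel Omega)) by exact: open_borel.
  have oD : open (V `\` E) by apply: openI => //; exact: closed_openC.
  have split1 : m1 (V `\` E) = m1 V - m1 E.
    apply: EFin_inj; rewrite EFinB -!m1E//; last exact: measurableD.
    by rewrite measureD// ?(setIidr EV)// -ge0_fin_numE// fin_num_measure.
  have split2 : m2 (V `\` E) = m2 V - m2 E.
    apply: EFin_inj; rewrite EFinB -!m2E//; last exact: measurableD.
    by rewrite measureD// ?(setIidr EV)// -ge0_fin_numE// fin_num_measure.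
  have shrink : m1 (V `\` E) <= q * m1 V.
    rewrite split1 /q mulrBl mul1r lerD2l lerN2.
    by rewrite -(ler_pM2l C20) mulrA mulfV ?mul1r ?gt_eqF.
  have := IH _ oD; rewrite split1 split2 eqE.
  rewrite opprB addrA subrK => /le_trans; apply.
  rewrite -eqE -split1 exprSr -mulrA ler_wpM2l// exprn_ge0//.
move=> oU; rewrite -subr_le0; apply/ler_addgt0Pr => e e0; rewrite add0r.
have : (q ^+ k) @[k --> \oo] --> (0 : R) by apply: cvg_expr; rewrite ger0_norm.
move=> /cvgr_lt/(_ e e0)/filter_ex[k qk].
apply: (le_trans (iter k U oU)); apply: le_trans (ltW qk).
rewrite -[leRHS]mulr1 ler_wpM2l ?exprn_ge0//.
rewrite -lee_fin -m1E; last exact: open_borel.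
by apply: probability_le1; exact: open_borel.
Qed.

(** Passing to complements reverses the comparison on closed sets, and an open
    set is an increasing union of closed sets. *)
Lemma doubling_comparison_same_law : same_law nu1 nu2.
Proof.
have le12 (U : set Omega) : open U -> (nu1 U <= nu2 U)%E.
  move=> oU; have mU : measurable (U : set (borel Omega)) by exact: open_borel.
  by rewrite m1E// m2E// lee_fin; exact: open_measure_le.
have le21 (A : set Omega) : closed A -> (nu2 A <= nu1 A)%E.
  move=> cA.
  have mA : measurable (A : set (borel Omega)) by exact: closed_borel.
  have mC := measurableC mA.
  have := open_measure_le (closed_openC cA).
  have n1 : nu1 (~` A) = (1 - (m1 A)%:E)%E by rewrite probability_setC// m1E.
  have n2 : nu2 (~` A) = (1 - (m2 A)%:E)%E by rewrite probability_setC// m2E.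
  rewrite /m1 /m2 n1 n2 -!EFinB/= lerD2l lerN2 => h.
  by rewrite m1E// m2E// lee_fin.
have eqO (U : set Omega) : open U -> nu1 U = nu2 U.
  move=> oU; apply/eqP; rewrite eq_le le12//=.
  have mU : measurable (U : set (borel Omega)) by exact: open_borel.
  pose F k : set (borel Omega) := [set x | ball x k.+1%:R^-1 `<=` U].
  have cF k : closed (F k : set Omega) by exact: closed_ball_sub.
  have mF k : measurable (F k) by exact: closed_borel.
  have FU k : F k `<=` U.
    by move=> x; apply; rewrite ballEmdist/= mdistxx.
  have UF : \bigcup_k F k = U.
    apply/seteqP; split=> [x [k _ /FU//]|x Ux].
    have /nbhs_ballP[e /= e0 eU] : nbhs x U by exact: open_nbhs_nbhs.
    have [k] := ltr_add_invr e0; rewrite add0r => ke; exists k => //.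
    by apply: subset_trans eU; apply: le_ball; exact: ltW.
  have F_nd : nondecreasing_seq F.
    move=> k l kl; apply/subsetPset => x; apply: subset_trans.
    by apply: le_ball; rewrite lef_pV2 ?posrE// ler_nat.
  have mbF : measurable (\bigcup_k F k) by exact: bigcup_measurable.
  have cvgF := nondecreasing_cvg_mu (mu := nu2) mF mbF F_nd.
  rewrite -UF -(cvg_lim _ cvgF)//; apply: lime_le.
    by apply/cvg_ex; exists (nu2 (\bigcup_k F k)).
  apply: nearW => k /=; apply: (le_trans (le21 _ (cF k))).
  by apply: le_measure; rewrite ?inE//; exact: bigcup_sup.
move=> A mA.
apply: (@measure_unique _ R (borel Omega) (@open Omega) (fun=> setT) erefl _ _ _
  nu1 nu2) => //.
- by move=> U V; exact: openI.
- by move=> _; exact: openT.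
- by apply/seteqP; split=> // x _; exists 0%N.
- by move=> _; rewrite [X in (X < _)%E](probability_setT nu1) ltry.
Qed.

End doubling_comparison.

(** A doubling measure is determined by the masses of the balls around its own
    support points, even against competitors with a different support. *)
Theorem doubling_same_law (R : realType) (Omega : pmetricType R)
    (nu1 nu2 : probability (borel Omega) R) :
  entropy_condition Omega -> separable Omega -> lipschitz_profiles nu1 ->
  doubling nu1 ->
  (forall x r, msupport nu1 x -> 0 <= r ->
    profile nu1 x r = profile nu2 x r) -> same_law nu1 nu2.
Proof.
move=> ent sep lip1 /doubling_profile[C C1 dC] eqF.
exact: (doubling_comparison_same_law ent sep lip1 eqF C1 dC).
Qed.

(** * Divergence of the statistics under a fixed alternative *)

Section matrix_norm.
Context {R : realType}.

Lemma ler_entry_norm m n (A : 'M[R]_(m, n)) i j : `|A i j| <= `|A|.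
Proof.
rewrite [leRHS](mx_normrE A).
exact: (le_bigmax _ (fun k : 'I_m * 'I_n => `|A k.1 k.2|) (i, j)).
Qed.

Lemma ler_norm_mulmx3 p (g : 'rV[R]_p) (W : 'M[R]_p) (v : 'cV[R]_p) :
  `|(g *m W *m v) 0 0| <= (p ^ 2)%:R * (`|g| * `|W| * `|v|).
Proof.
rewrite mxE; apply: (le_trans (ler_norm_sum _ _ _)).
apply: (@le_trans _ _ (\sum_(j < p) p%:R * (`|g| * `|W| * `|v|))); last first.
  by rewrite sumr_const card_ord -[leLHS]mulr_natl mulrA -natrM.
apply: ler_sum => j _; rewrite normrM mulrA ler_pM ?ler_entry_norm//.
rewrite mxE; apply: (le_trans (ler_norm_sum _ _ _)).
apply: (@le_trans _ _ (\sum_(i < p) `|g| * `|W|)); last first.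
  by rewrite sumr_const card_ord -[leLHS]mulr_natl.
by apply: ler_sum => i _; rewrite normrM ler_pM ?ler_entry_norm.
Qed.

End matrix_norm.

Section empirical_profiles.
Context {R : realType} (Omega : pmetricType R).
Implicit Types (x y z : Omega) (r s t : R) (u : nat -> Omega).

Lemma emp_profileE n u x t :
  emp_profile n u x t = n%:R^-1 * \sum_(i < n) \1_(cball x t) (u i).
Proof.
rewrite /emp_profile /emp_mean; congr (_ * _); apply: eq_bigr => i _.
by rewrite indicE; congr ((nat_of_bool _)%:R); apply/idP/idP; rewrite inE.
Qed.

Lemma emp_profile_subset n u x s y t : cball x s `<=` cball y t ->
  emp_profile n u x s <= emp_profile n u y t.
Proof.
move=> st; rewrite !emp_profileE ler_wpM2l ?invr_ge0//.
apply: ler_sum => i _; rewrite !indicE ler_nat.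
have [us|//] := boolP (u i \in cball x s); rewrite (_ : u i \in cball y t)//.
by move: us; rewrite !inE; exact: st.
Qed.

Lemma sqrt_natr_large (M : R) : \forall n \near \oo, M < Num.sqrt n%:R.
Proof.
have : \forall n \near \oo, `|M| ^+ 2 < n%:R :> R by exact: nbhs_infty_gtr.
apply: filterS => n Mn; apply: (le_lt_trans (ler_norm M)).
rewrite -(@ger0_norm _ `|M|)// -sqrtr_sqr ltr_sqrt//.
by rewrite (le_lt_trans _ Mn)// sqr_ge0.
Qed.

(** Only the pairs in [A * B] are kept in the double sum. *)
Lemma CMstat_ge n u (g : Omega -> R -> R) (A B : set Omega) (m : R) :
  (0 < n)%N -> 0 <= m ->
  (forall i j : 'I_n, A (u i) -> B (u j) ->
     m <= g (u i) (mdist (u i) (u j)) ^+ 2) ->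
  (((n%:R^-1 * \sum_(i < n) \1_A (u i))
     * (n%:R^-1 * \sum_(i < n) \1_B (u i)) * m)%R%:E <= CMstat n u g)%E.
Proof.
move=> n0 m0 H; rewrite /CMstat lee_fin.
rewrite mulrACA -invfM -expr2 -mulrA ler_pM2l ?invr_gt0 ?exprn_gt0 ?ltr0n//.
rewrite mulr_suml mulr_suml; apply: ler_sum => i _.
rewrite mulr_sumr mulr_suml; apply: ler_sum => j _.
rewrite !indicE; have [uA|uA] := boolP (u i \in A); last first.
  by rewrite !mul0r sqr_ge0.
have [uB|uB] := boolP (u j \in B); last by rewrite mulr0 mul0r sqr_ge0.
by rewrite !mul1r; apply: H; [rewrite inE in uA|rewrite inE in uB].
Qed.

End empirical_profiles.

Section fixed_alternative.
Context {R : realType} (Omega : pmetricType R).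
Context d {T : measurableType d} (P : probability T R).
Variable mu : probability (borel Omega) R.
Variable X : nat -> {RV P >-> borel Omega}.
Hypothesis iidX : iid mu X.
Implicit Types (x y z : Omega) (r s t : R) (nu : probability (borel Omega) R).

Let sample (w : T) (i : nat) : Omega := X i w.

(** The process [g] is [sqrt n] times the deviation of the empirical profile
    from the profile of [nu], up to an error [o_P (sqrt n)] that is uniform in
    the center and the radius. *)
Definition tracks_deviation nu (g : nat -> T -> Omega -> R -> R) :=
  forall e : R, 0 < e -> vanishing P (fun n => [set w | exists x t, 0 <= t /\
    Num.sqrt n%:R * e <
    `|g n w x t - Num.sqrt n%:R *
        (emp_profile n (sample w) x t - profile nu x t)|]).

Lemma emp_profile_lln x t (e : R) : 0 < e ->
  vanishing P (fun n =>
    [set w | e < `|emp_profile n (sample w) x t - profile mu x t|]).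
Proof.
move=> e0; apply: sub_vanishing (indicator_lln iidX (measurable_cball x t) e0).
by apply: nearW => n w /=; rewrite emp_profileE.
Qed.

(** A supremum only needs one center and radius at which the two profiles
    differ, so that the pointwise law of large numbers suffices. *)
Lemma KSstat_diverges nu g : tracks_deviation nu g ->
  (exists x t, 0 <= t /\ profile mu x t <> profile nu x t) ->
  diverges_in_outer_probability P (fun n w => KSstat (g n w)).
Proof.
move=> gnu [x [t [t0 /eqP neq]]] K.
pose c := `|profile mu x t - profile nu x t|.
have c0 : 0 < c by rewrite normr_gt0 subr_eq0.
have c4 : 0 < c / 4 by rewrite divr_gt0.
apply: sub_vanishing (vanishingU (emp_profile_lln x t c4) (gnu _ c4)).
have := sqrt_natr_large (K / (c / 2)); apply: filterS => n.
rewrite ltr_pdivrMr ?divr_gt0// => nK w /= KSK.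
apply: contrapT => /not_orP[/negP]; rewrite -leNgt => lln nt.
have gt : `|g n w x t - Num.sqrt n%:R *
    (emp_profile n (sample w) x t - profile nu x t)| <= Num.sqrt n%:R * (c / 4).
  by rewrite leNgt; apply/negP => H; apply: nt; exists x, t.
have gK : `|g n w x t| <= K.
  rewrite -lee_fin; apply: le_trans KSK; apply: ereal_sup_ubound.
  by exists (x, t).
set sn := Num.sqrt n%:R in nK gt *; have sn0 : 0 <= sn by exact: sqrtr_ge0.
pose D := emp_profile n (sample w) x t - profile nu x t.
have cD : c <= c / 4 + `|D|.
  apply: le_trans (ler_distD (emp_profile n (sample w) x t) _ _) _.
  by rewrite lerD// distrC.
have snD : sn * (c - c / 4) <= `|sn * D|.
  by rewrite normrM (ger0_norm sn0) ler_wpM2l//; lra.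
have := ler_distD (g n w x t) 0 (sn * D); rewrite !sub0r !normrN.
move: gt; rewrite -/D; nra.
Qed.

(** Monotonicity of profiles in the radius turns the pointwise law of large
    numbers at [x0] with the two radii [t0 - 3 * e] and [t0 + 3 * e] into a
    bound that is uniform over all pairs of observations close to [x0] and [y0];
    a positive fraction of the pairs is of this kind. *)
Lemma CMstat_diverges nu g : lipschitz_profiles mu -> lipschitz_profiles nu ->
  tracks_deviation nu g ->
  (exists x y, [/\ msupport mu x, msupport mu y &
     profile mu x (mdist x y) <> profile nu x (mdist x y)]) ->
  diverges_in_outer_probability P (fun n w => CMstat n (sample w) (g n w)).
Proof.
move=> lip1 lip2 gnu [x0 [y0 [sx sy neq]]] K.
pose t0 := mdist x0 y0.
(* a positive radius leaves room for the lower sandwich radius *)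
have t0_gt0 : 0 < t0.
  rewrite lt0r mdist_ge0 andbT; apply/eqP => t00; apply: neq.
  by rewrite -/t0 t00; exact: profile0_eq.
have {neq} /eqP neq := neq.
pose c := `|profile mu x0 t0 - profile nu x0 t0|.
have c0 : 0 < c by rewrite normr_gt0 subr_eq0.
have c8 : 0 < c / 8 by rewrite divr_gt0.
have [K1 K10 l1] := lip1; have [K2 K20 l2] := lip2.
have K12 : 0 < 24 * (K1 + K2) by rewrite mulr_gt0// addr_gt0.
(* each Lipschitz error over a radius change of [3 * e] is at most [c / 8] *)
pose e := Num.min (t0 / 3) (c / (24 * (K1 + K2))).
have e0 : 0 < e by rewrite lt_min !divr_gt0.
have et : 3 * e <= t0.
  by rewrite mulrC -ler_pdivlMr// ge_min lexx.
have ec : 24 * (K1 + K2) * e <= c.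
  by rewrite mulrC -ler_pdivlMr// ge_min lexx orbT.
have eK1 : 3 * K1 * e <= c / 8 by have := mulr_gt0 K20 e0; nra.
have eK2 : 3 * K2 * e <= c / 8 by have := mulr_gt0 K10 e0; nra.
have tp : 0 <= t0 + 3 * e by rewrite addr_ge0 ?mulr_ge0// ltW.
have tm : 0 <= t0 - 3 * e by rewrite subr_ge0.
have dp : `|t0 + 3 * e - t0| = 3 * e.
  by rewrite addrAC subrr add0r gtr0_norm// mulr_gt0.
have dm : `|t0 - 3 * e - t0| = 3 * e.
  by rewrite addrAC subrr add0r normrN gtr0_norm// mulr_gt0.
have l1p := l1 x0 _ _ tp (ltW t0_gt0); have l1m := l1 x0 _ _ tm (ltW t0_gt0).
have l2p := l2 x0 _ _ tp (ltW t0_gt0); have l2m := l2 x0 _ _ tm (ltW t0_gt0).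
rewrite dp dm !ler_norml in l1p l1m l2p l2m.
pose A : set Omega := ball x0 e; pose B : set Omega := ball y0 e.
have mA : measurable (A : set (borel Omega)).
  by apply: open_borel; exact: open_mball.
have mB : measurable (B : set (borel Omega)).
  by apply: open_borel; exact: open_mball.
pose a := fine (mu A); pose b := fine (mu B).
have a0 : 0 < a.
  rewrite -lte_fin fineK ?fin_num_measure//; apply: (msupport_gt0 sx).
    exact: open_mball.
  by rewrite /A ballEmdist/= mdistxx.
have b0 : 0 < b.
  rewrite -lte_fin fineK ?fin_num_measure//; apply: (msupport_gt0 sy).
    exact: open_mball.
  by rewrite /B ballEmdist/= mdistxx.
have a20 : 0 < a / 2 by rewrite divr_gt0.
have b20 : 0 < b / 2 by rewrite divr_gt0.
apply: sub_vanishing (vanishingU (vanishingU (vanishingU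
    (emp_profile_lln x0 (t0 + 3 * e) c8) (emp_profile_lln x0 (t0 - 3 * e) c8))
  (vanishingU (indicator_lln iidX mA a20) (indicator_lln iidX mB b20)))
  (gnu _ c8)).
pose k := a / 2 * (b / 2) * (c / 2) ^+ 2.
have k0 : 0 < k by rewrite !mulr_gt0// exprn_gt0// divr_gt0.
have nearK : \forall n \near \oo, `|K| / k < n%:R by exact: nbhs_infty_gtr.
have near1 : \forall n \near \oo, (0 < n)%N by exact: nbhs_infty_gt.
apply: filterS2 nearK near1 => n nK n0 w /= CMK.
apply: contrapT => /not_orP[/not_orP[/not_orP[/negP + /negP +]
  /not_orP[/negP + /negP +]] nt].
rewrite -!leNgt -/a -/b => llnp llnm llnA llnB.
set sn := Num.sqrt n%:R in nt.
have sn0 : 0 <= sn by exact: sqrtr_ge0.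
have sn2 : sn ^+ 2 = n%:R by rewrite sqr_sqrtr.
have key i j : A (sample w i) -> B (sample w j) ->
    n%:R * (c / 2) ^+ 2 <=
      g n w (sample w i) (mdist (sample w i) (sample w j)) ^+ 2.
  set x := sample w i; set y := sample w j.
  rewrite /A /B !ballEmdist/= => xA yB.
  set t := mdist x y.
  have [tlo thi] : t0 - 2 * e <= t /\ t <= t0 + 2 * e.
    have := metric_triangle x0 x y0; have := metric_triangle x y y0.
    have := metric_triangle x x0 y; have := metric_triangle x0 y0 y.
    by rewrite (metric_sym x x0) (metric_sym y y0) -/t -/t0; lra.
  have subp : cball x t `<=` cball x0 (t0 + 3 * e).
    by move=> z; rewrite /cball/=; have := metric_triangle x0 x z; lra.
  have subm : cball x0 (t0 - 3 * e) `<=` cball x t.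
    move=> z; rewrite /cball/=; have := metric_triangle x x0 z.
    by rewrite (metric_sym x x0); lra.
  have h1 := emp_profile_subset n (sample w) subp.
  have h2 := emp_profile_subset n (sample w) subm.
  have h3 := profile_subset nu subp; have h4 := profile_subset nu subm.
  rewrite !ler_norml in llnp llnm.
  pose D := emp_profile n (sample w) x t - profile nu x t.
  have gt : `|g n w x t - sn * D| <= sn * (c / 8).
    rewrite leNgt; apply/negP => H; apply: nt; exists x, t.
    by split; first exact: mdist_ge0.
  have Dc : c * (5 / 8) <= `|D|.
    have E1 : profile mu x0 t0 - profile nu x0 t0 - c * (3 / 8) <= D.
      rewrite /D; lra.
    have E2 : D <= profile mu x0 t0 - profile nu x0 t0 + c * (3 / 8).
      rewrite /D; lra.
    rewrite ler_normr; move: c0 E1 E2; rewrite /c.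
    have [?|?] := leP 0 (profile mu x0 t0 - profile nu x0 t0).
      by rewrite ger0_norm//; move=> *; apply/orP; left; lra.
    by rewrite ltr0_norm//; move=> *; apply/orP; right; lra.
  have gc : sn * (c / 2) <= `|g n w x t|.
    have := ler_wpM2l sn0 Dc; rewrite -{2}(ger0_norm sn0) -normrM => snD.
    have := ler_distD (g n w x t) 0 (sn * D); rewrite !sub0r !normrN.
    lra.
  rewrite -sn2 -exprMn -[leRHS]real_normK ?num_real//.
  by rewrite ler_sqr// nnegrE mulr_ge0// ltW// divr_gt0.
have m0 : 0 <= n%:R * (c / 2) ^+ 2 by rewrite mulr_ge0// sqr_ge0.
have := le_trans (CMstat_ge n0 m0 key) CMK; rewrite lee_fin.
apply/negP; rewrite -ltNge.
apply: (le_lt_trans (ler_norm K)).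
move: nK; rewrite ltr_pdivrMr// => /lt_le_trans; apply.
rewrite mulrC /k mulrAC -mulrA; apply: ler_pM.
- by rewrite mulr_ge0// ltW.
- exact: m0.
- by rewrite !ler_norml in llnA llnB; apply: ler_pM; lra.
- by rewrite mulrC.
Qed.

End fixed_alternative.

(** * The two processes and the theorem *)

Section tracking.
Context {R : realType} (Omega : pmetricType R) (p : nat).
Context d {T : measurableType d} (P : probability T R).
Variable Theta : set 'rV[R]_p.
Variable mu_ : 'rV[R]_p -> probability (borel Omega) R.
Variable X : nat -> {RV P >-> borel Omega}.
Variables (thetahat : nat -> T -> 'rV[R]_p) (theta1 : 'rV[R]_p).
Hypothesis thetahat_in : forall n w, Theta (thetahat n w).
Hypothesis consistent : cvg_in_probability P thetahat theta1.
Hypothesis continuous_at :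
  sup_norm (fun (w : Omega) t =>
      profile (mu_ theta) w t - profile (mu_ theta1) w t)
    @[theta --> within Theta (nbhs theta1)] --> (0 : \bar R)%E.

Let sample (w : T) (i : nat) : Omega := X i w.

Lemma sup_norm_ge (g : Omega -> R -> R) x t :
  0 <= t -> (`|g x t|%:E <= sup_norm g)%E.
Proof. by move=> t0; apply: ereal_sup_ubound; exists (x, t). Qed.

Lemma plugin_profile_vanishing (e : R) : 0 < e ->
  vanishing P (fun n => [set w | exists x t, 0 <= t /\
    e < `|profile (mu_ (thetahat n w)) x t - profile (mu_ theta1) x t|]).
Proof.
move=> e0.
have : \forall theta \near within Theta (nbhs theta1),
    (sup_norm (fun (w : Omega) t =>
      profile (mu_ theta) w t - profile (mu_ theta1) w t)%R < e%:E)%E.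
  move/fine_cvgP : continuous_at => [ffin /cvgr_lt/(_ _ e0)].
  apply: filterS2 ffin => theta fin_theta /=.
  by rewrite -lte_fin fineK.
rewrite /within/= => /nbhs_ballP[h /= h0 hb].
have h2 : 0 < h / 2 by rewrite divr_gt0.
apply: sub_vanishing (consistent h2); apply: nearW => n w /= [x [t [t0 et]]].
rewrite ltNge; apply/negP => close.
have : ball theta1 h (thetahat n w).
  rewrite -ball_normE/= distrC (le_lt_trans close)// ltr_pdivrMr// ltr_pMr//.
  by rewrite ltr1n.
move=> /hb/(_ (thetahat_in n w)) lt_e.
have := le_lt_trans (sup_norm_ge (fun x t => profile (mu_ (thetahat n w)) x t
  - profile (mu_ theta1) x t) x t0) lt_e.
by rewrite lte_fin ltNge (ltW et).
Qed.

Lemma Gproc_tracks_deviation : tracks_deviation X (mu_ theta1)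
  (fun n w => Gproc mu_ n (sample w) (thetahat n w)).
Proof.
move=> e e0; apply: sub_vanishing (plugin_profile_vanishing e0).
have n0 : \forall n \near \oo, (0 < n)%N by exact: nbhs_infty_gt.
apply: filterS n0 => n n0 w /= [x [t [t0]]].
rewrite /Gproc -mulrBr normrM ger0_norm ?sqrtr_ge0//.
rewrite ltr_pM2l ?sqrtr_gt0 ?ltr0n// => et; exists x, t; split=> //.
apply: lt_le_trans et _; rewrite distrC le_eqVlt; apply/orP; left.
by apply/eqP; congr `|_|; rewrite /sample; ring.
Qed.

Variable psi : 'rV[R]_p -> borel Omega -> 'cV[R]_p.
Variable Vhat : nat -> T -> 'M[R]_p.

(** The estimation correction of [fhat] is linear in [psi], hence its empirical
    mean only involves the empirical mean of [psi]. *)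
Lemma GhatprocE n u th V x t : (0 < n)%N ->
  Ghatproc mu_ psi n u th V x t = Gproc mu_ n u th x t + Num.sqrt n%:R *
    (grad_profile mu_ th x t *m invmx V *m emp_mean n u (psi th)) 0 0.
Proof.
move=> n0; rewrite /Ghatproc /Gproc -mulrDr; congr (_ * _).
rewrite /emp_profile /emp_mean /fhat big_split/= big_split/= !scalerDr.
congr (_ + _ + _).
  have nR : n%:R != 0 :> R by rewrite pnatr_eq0 -lt0n.
  rewrite sumr_const card_ord.
  change (n%:R^-1 * (- profile (mu_ th) x t *+ n) = - profile (mu_ th) x t).
  by rewrite -[X in _ * X]mulr_natl mulrA mulVf ?mul1r.
by rewrite -scalemxAr mulmx_sumr mxE summxE.
Qed.

(** The correction is uniformly a product [O_P(1) * o_P(1)]. *)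
Lemma Ghatproc_tracks_deviation :
  bounded_in_probability P
    (fun n w => score_bound mu_ (thetahat n w) (Vhat n w)) ->
  cvg_in_probability P
    (fun n w => emp_mean n (sample w) (psi (thetahat n w))) 0 ->
  tracks_deviation X (mu_ theta1)
    (fun n w => Ghatproc mu_ psi n (sample w) (thetahat n w) (Vhat n w)).
Proof.
move=> bounded small e e0.
have e2 : 0 < e / 2 by rewrite divr_gt0.
pose corr n w x t := (grad_profile mu_ (thetahat n w) x t *m invmx (Vhat n w)
  *m emp_mean n (sample w) (psi (thetahat n w))) 0 0.
have corr0 : vanishing P (fun n =>
    [set w | exists x t, 0 <= t /\ e / 2 < `|corr n w x t|]).
  apply/vanishingP => h h0; have h2 : 0 < h / 2 by rewrite divr_gt0.
  have [M bM] := bounded _ h2.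
  pose c := (p ^ 2)%:R * `|M| + 1.
  have c0 : 0 < c by rewrite ltr_wpDl// mulr_ge0.
  have dl0 : 0 < e / 2 / c by rewrite divr_gt0.
  have /vanishingP/(_ _ h2) := small _ dl0.
  apply: filterS2 bM => n bMn smalln.
  rewrite (splitr h) EFinD; apply: le_trans (leeD bMn smalln).
  apply: le_trans (outer_setU _ _ _); apply: outer_subset.
  move=> w /= [x [t [t0 et]]]; apply: contrapT => /not_orP[/negP + /negP].
  rewrite -leNgt -leNgt subr0 => boundM meanle.
  have gV :
      `|grad_profile mu_ (thetahat n w) x t| * `|invmx (Vhat n w)| <= `|M|.
    rewrite -lee_fin; apply: (@le_trans _ _ M%:E).
      2: by rewrite lee_fin ler_norm.
    apply: le_trans boundM; apply: le_trans (lee_abs _).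
    by apply: ereal_sup_ubound; exists (x, t).
  suff : `|corr n w x t| <= e / 2 by rewrite leNgt et.
  apply: (le_trans (ler_norm_mulmx3 _ _ _)).
  have -> : e / 2 = c * (e / 2 / c) by rewrite mulrCA divff ?mulr1// gt_eqF.
  rewrite mulrA; apply: ler_pM => //.
  by rewrite /c; apply: ler_wpDr => //; rewrite ler_wpM2l.
have n0 : \forall n \near \oo, (0 < n)%N by exact: nbhs_infty_gt.
apply: sub_vanishing (vanishingU corr0 (Gproc_tracks_deviation e2)).
apply: filterS n0 => n n0 w /= [x [t [t0]]].
rewrite GhatprocE// -/(corr n w x t) => et.
apply: contrapT => /not_orP[ncorr ndev].
have h1 : `|corr n w x t| <= e / 2.
  by rewrite leNgt; apply/negP => H; apply: ncorr; exists x, t.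
set sn := Num.sqrt n%:R in et ndev; have sn0 : 0 <= sn by exact: sqrtr_ge0.
set dev := sn * (emp_profile n _ x t - profile _ x t) in et.
have h2 : `|Gproc mu_ n (sample w) (thetahat n w) x t - dev| <= sn * (e / 2).
  by rewrite leNgt; apply/negP => H; apply: ndev; exists x, t.
have h3 : `|sn * corr n w x t| <= sn * (e / 2).
  by rewrite normrM (ger0_norm sn0) ler_wpM2l.
move: et; apply/negP; rewrite -leNgt addrAC.
by apply: (le_trans (ler_normD _ _)); lra.
Qed.

End tracking.

Section alternatives.
Context {R : realType} (Omega : pmetricType R).
Variables mu nu : probability (borel Omega) R.
Hypothesis sep : separable Omega.
Hypothesis entropy : entropy_condition Omega.
Hypothesis lip1 : lipschitz_profiles mu.
Hypothesis lip2 : lipschitz_profiles nu.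
Hypothesis mu_nu : ~ same_law mu nu.

Lemma ex_profile_neq : power_strong_negative_type Omega \/ doubling mu ->
  exists x t, 0 <= t /\ profile mu x t <> profile nu x t.
Proof.
move=> H; apply: contrapT => nex; apply: mu_nu.
have eqF x t : 0 <= t -> profile mu x t = profile nu x t.
  by move=> t0; apply: contrapT => neq; apply: nex; exists x, t.
case: H => [snt|dbl].
  apply: (strong_negative_type_same_law entropy snt); exists setT.
  split; [exact: measurableT|by rewrite setCT measure0..|].
  by move=> x t _; exact: eqF.
apply: (doubling_same_law entropy sep lip1 dbl) => x r _; exact: eqF.
Qed.

(** The strong negative type alternative needs both energies to be integrated
    over points where the profiles are known to agree, hence the inclusion of
    supports; doubling only concerns balls around points of [msupport mu]. *)
Lemma ex_support_profile_neq :
  (power_strong_negative_type Omega /\ msupport nu `<=` msupport mu) \/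
    doubling mu ->
  exists x y, [/\ msupport mu x, msupport mu y &
    profile mu x (mdist x y) <> profile nu x (mdist x y)].
Proof.
move=> H; apply: contrapT => nex; apply: mu_nu.
have eqF x t : msupport mu x -> 0 <= t -> profile mu x t = profile nu x t.
  move=> sx; apply: profile_eq_extend => // y sy.
  by apply: contrapT => neq; apply: nex; exists x, y.
case: H => [[snt sub]|dbl].
  2: exact: (doubling_same_law entropy sep lip1 dbl).
apply: (strong_negative_type_same_law entropy snt); exists (msupport mu).
have mS (eta : probability (borel Omega) R) :
    measurable (~` msupport eta : set (borel Omega)).
  by apply: measurableC; apply: closed_borel; exact: closed_msupport.
split=> //.
- by apply: closed_borel; exact: closed_msupport.
- exact: measure_msupportC.
- apply/eqP; rewrite -measure_le0 -(measure_msupportC nu sep).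
  by apply: le_measure; rewrite ?inE//; exact: subsetC.
Qed.

End alternatives.

Theorem theorem5p2
  (R : realType) (Omega : pmetricType R) (p : nat)
  (Theta : set 'rV[R]_p) (mu_ : 'rV[R]_p -> probability (borel Omega) R)
  (mu : probability (borel Omega) R)
  (d : measure_display) (T : measurableType d) (P : probability T R)
  (X : nat -> {RV P >-> borel Omega})
  (est : forall n : nat, n.-tuple (borel Omega) -> 'rV[R]_p)
  (theta1 : 'rV[R]_p)
  (psi : 'rV[R]_p -> borel Omega -> 'cV[R]_p)
  (Vhat : nat -> T -> 'M[R]_p) :
  let sample (w : T) (i : nat) : Omega := X i w in
  let thetahat (n : nat) (w : T) := est n [tuple X i w | i < n] in
  let tildeT_KS (n : nat) (w : T) :=
    KSstat (Gproc mu_ n (sample w) (thetahat n w)) in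
  let tildeT_CM (n : nat) (w : T) :=
    CMstat n (sample w) (Gproc mu_ n (sample w) (thetahat n w)) in
  let hatT_KS (n : nat) (w : T) :=
    KSstat (Ghatproc mu_ psi n (sample w) (thetahat n w) (Vhat n w)) in
  let hatT_CM (n : nat) (w : T) :=
    CMstat n (sample w)
      (Ghatproc mu_ psi n (sample w) (thetahat n w) (Vhat n w)) in
  let a1 := power_strong_negative_type Omega in
  let a2 := doubling mu /\ (forall theta, Theta theta -> doubling (mu_ theta)) in
  let score_condition :=
    bounded_in_probability P
      (fun n w => score_bound mu_ (thetahat n w) (Vhat n w)) /\
    cvg_in_probability P
      (fun n w => emp_mean n (sample w) (psi (thetahat n w))) 0 in
  separable Omega ->
  open Theta ->
  Theta theta1 ->
  iid mu X ->
  (forall n, measurable_mx (est n)) ->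
  (forall n x, Theta (est n x)) ->
  cvg_in_probability P thetahat theta1 ->
  (forall theta, Theta theta -> measurable_mx (psi theta)) ->
  (forall n, measurable_mx (Vhat n)) ->
  P [set w | Vhat n w \in unitmx] @[n --> \oo] --> (1 : \bar R)%E ->
  sup_norm (fun (w : Omega) t => profile (mu_ theta) w t - profile (mu_ theta1) w t)
    @[theta --> within Theta (nbhs theta1)] --> (0 : \bar R)%E ->
  entropy_condition Omega ->
  lipschitz_profiles mu ->
  lipschitz_profiles (mu_ theta1) ->
  a1 \/ a2 ->
  (forall theta, Theta theta -> ~ same_law mu (mu_ theta)) ->
  (diverges_in_outer_probability P tildeT_KS /\
   (score_condition -> diverges_in_outer_probability P hatT_KS)) /\
  (a2 \/ (a1 /\ msupport (mu_ theta1) `<=` msupport mu) ->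
   diverges_in_outer_probability P tildeT_CM /\
   (score_condition -> diverges_in_outer_probability P hatT_CM)).

Proof.
move=> sample thetahat tT_KS tT_CM hT_KS hT_CM a1 a2 score sep _ th1 iidX _
  est_in consistent _ _ _ cont ent lip1 lip2 a12 alt.
have neq := alt _ th1.
have that_in n w : Theta (thetahat n w) by exact: est_in.
have Gtrack := Gproc_tracks_deviation X that_in consistent cont.
have Ghtrack (H : score) :=
  Ghatproc_tracks_deviation that_in consistent cont H.1 H.2.
split=> [|H].
  have KS : exists x t, 0 <= t /\ profile mu x t <> profile (mu_ theta1) x t.
    by apply: ex_profile_neq => //; case: a12 => [|[]]; [left|right].
  by split=> [|/Ghtrack tr]; exact: (KSstat_diverges iidX _ KS).
have CM : exists x y, [/\ msupport mu x, msupport mu y &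
    profile mu x (mdist x y) <> profile (mu_ theta1) x (mdist x y)].
  by apply: ex_support_profile_neq => //; case: H => [[]|]; [right|left].
by split=> [|/Ghtrack tr]; exact: (CMstat_diverges iidX lip1 lip2 _ CM).
Qed.
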